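(* Assume $\beta<\infty$ and $\gamma<\infty$. Let $f:\mathbb{R}\to\mathbb{C}$ be $k+4$ times continuously differentiable, with $f'',\dots,f^{(k+4)}$ bounded, and put $C=\|f''\|+\dots+\|f^{(k+4)}\|$. Then $$\Big|\int_{\mathbb{R}}f(u)\,d\mathbb{P}\{\mathbb{S}\le u\}-\int_{\mathbb{R}}f(u)\,dN_k(u)\Big|\le c\,C(\beta+\gamma),$$ where $c>0$ depends only on $k$.
   Context: **Setting.** Let $k\ge1$ and $n\ge1$ be integers. Let $X,X_1,\dots,X_n$ be i.i.d. random variables. Let $l$ be a real Borel function. For $p=1,\dots,k$, let $t_p$ be a real Borel function of $p$ variables that is invariant under permutations of its arguments. Put $L_i=l(X_i)$. For $A=\{j_1,\dots,j_p\}\subset\{1,\dots,n\}$ with $|A|=p$, put $T_A=t_p(X_{j_1},\dots,X_{j_p})$, and write $T_{1\dots p}=T_{\{1,\dots,p\}}$. Define - $\mathbb{L}=\sum_iL_i$, - $\mathbb{T}_p=\sum_{|A|=p}T_A$, - $\mathbb{T}=\mathbb{T}_1+\dots+\mathbb{T}_k$, - $\mathbb{S}=\mathbb{L}+\mathbb{T}$. **Standing assumptions.** - $\mathbb{E}L_1=0$ and $n\,\mathbb{E}L_1^2=1$. - Each $t_p(X_1,\dots,X_p)$ is integrable and degenerate: $\mathbb{E}[t_p(X_1,\dots,X_p)\mid X_2,\dots,X_p]=0$ a.s. For $p=1$ this means $\mathbb{E}t_1(X_1)=0$. **Notation.** - $\beta=n\,\mathbb{E}|L_1|^3$. - $\gamma=\operatorname{var}\mathbb{T}$.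 - $\kappa_p=\binom{n}{p}\mathbb{E}[L_1\cdots L_p\,\mathbb{T}]$. - $\Phi$ is the standard normal distribution function. - $N_k(x)=\Phi(x)+\sum_{j=1}^k(-1)^{j+1}\kappa_j\Phi^{(j+1)}(x)$; thus $\int f\,dN_k=\mathbb{E}f(\eta)+\sum_{j=1}^k\kappa_j\mathbb{E}f^{(j+1)}(\eta)$ with $\eta\sim N(0,1)$. - $\|h\|=\sup_x|h(x)|$. *)

(* Defs.v *)
From HB Require Import structures.
From mathcomp Require Import all_boot all_order all_algebra.
From mathcomp Require Import all_classical all_reals all_analysis.
From mathcomp Require Import perm.
Set Implicit Arguments. Unset Strict Implicit. Unset Printing Implicit Defensive.
Import Order.TTheory GRing.Theory Num.Theory.
Import numFieldNormedType.Exports.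
Local Open Scope classical_set_scope.
Local Open Scope ring_scope.

Section defs.
Context {R : realType}.

(* Borel sigma-algebra on R^p = ('I_p -> R): generated by the coordinate cylinders. *)
Definition cylinders (p : nat) : set (set ('I_p -> R)) :=
  [set A | exists (i : 'I_p) (B : set R),
     measurable B /\ A = (fun x : 'I_p -> R => x i) @^-1` B].

Definition borel_fun_p (p : nat) (t : ('I_p -> R) -> R) : Prop :=
  forall B : set R, measurable B -> smallest (sigma_algebra [set: 'I_p -> R]) (@cylinders p) (t @^-1` B).

Definition symmetric_fun (p : nat) (t : ('I_p -> R) -> R) : Prop :=
  forall (s : {perm 'I_p}) (x : 'I_p -> R), t (fun i => x (s i)) = t x.

Context {d : measure_display} {T : measurableType d}.

Definition sigma_gen {I : Type} (Y : I -> T -> R) (J : set I) : set (set T) :=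
  smallest (sigma_algebra [set: T])
    [set E | exists j B, J j /\ measurable B /\ E = Y j @^-1` B].

Definition mutually_independent (P : probability T R) (n : nat)
    (X : 'I_n -> T -> R) : Prop :=
  forall B : 'I_n -> set R, (forall i, measurable (B i)) ->
    P [set w | forall i, B i (X i w)] = \big[*%E/1%E]_(i < n) P (X i @^-1` B i).

Definition identically_distributed (P : probability T R) (n : nat)
    (X : 'I_n -> T -> R) : Prop :=
  forall (i j : 'I_n) (B : set R), measurable B ->
    P (X i @^-1` B) = P (X j @^-1` B).

Definition TA (n : nat) (t : forall p : nat, ('I_p -> R) -> R)
    (X : 'I_n -> T -> R) (A : {set 'I_n}) (w : T) : R :=
  t #|A| (fun i : 'I_#|A| => X (enum_val i) w).

Definition TTp (n : nat) (t : forall p : nat, ('I_p -> R) -> R)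
    (X : 'I_n -> T -> R) (p : nat) (w : T) : R :=
  \sum_(A : {set 'I_n} | #|A| == p) TA t X A w.

Definition TT (n k : nat) (t : forall p : nat, ('I_p -> R) -> R)
    (X : 'I_n -> T -> R) (w : T) : R :=
  \sum_(1 <= p < k.+1) TTp t X p w.

Definition LL (n : nat) (l : R -> R) (X : 'I_n -> T -> R) (w : T) : R :=
  \sum_(i < n) l (X i w).

Definition SS (n k : nat) (l : R -> R) (t : forall p : nat, ('I_p -> R) -> R)
    (X : 'I_n -> T -> R) (w : T) : R :=
  LL l X w + TT k t X w.

(* kappa_p = binom(n,p) E[L_1 ... L_p TT]  (for p > n the factor binom(n,p) is 0) *)
Definition kappa (P : probability T R) (n k : nat) (l : R -> R)
    (t : forall p : nat, ('I_p -> R) -> R) (X : 'I_n -> T -> R) (p : nat) : R :=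
  'C(n, p)%:R *
  fine ('E_P[(fun w => (\prod_(i < n | (i < p)%N) l (X i w)) * TT k t X w)%R])%E.

End defs.

Definition gaussE {R : realType} (g : R -> R) : R :=
  fine (\int[normal_prob 0 1]_x (g x)%:E)%E.

Definition int_dNk {R : realType} (kap : nat -> R) (k : nat) (g : R -> R) : R :=
  gaussE g + \sum_(1 <= j < k.+1) kap j * gaussE (derive1n j.+1 g).

Definition cmod {R : realType} (a b : R) : R := Num.sqrt (a ^+ 2 + b ^+ 2).

Definition csupnorm {R : realType} (fr fi : R -> R) : R :=
  sup [set cmod (fr x) (fi x) | x in [set: R]].

(* Main.v *)
(* Taylor's formula gives [f(L + T) = f(L) + f'(L) T + O(|f''| T^2)], and
   [E T^2 = gamma] because [T] is centered.  Lindeberg's replacement argument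
   bounds [E f(L) - E f(eta)] by a multiple of [beta]; Gaussian smoothing by the
   replaced summands keeps cubic Taylor remainders under control.

   For the linear term, degeneracy makes [E f'(L) T_A] equal to the expectation
   of [T_A] times the mixed difference of [f'] in the variables [L_i], [i] in
   [A].  By the iterated mean value theorem that mixed difference is the product
   [L_A] of the [L_i] times [f^(p+1)] at an intermediate point, [p] the size of
   [A].  Moving the point to [L] without its [A]-summands and then replacing the
   expectation of [f^(p+1)] by its Gaussian value leaves
   [E (L_A T_A) E f^(p+1)(eta)].  The errors are split pointwise by
   [2 a b <= a^2 + b^2] into [E T_A^2], which sum to [gamma] by orthogonality,
   and terms of order [beta n^(-p)], which sum to a multiple of [beta].

   All statistics are transported to the law of [(X_1, ..., X_n)] on R^n.  There,
   taking the coordinates in [A] from one sample and the remaining ones from an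
   independent copy preserves the law, which turns independence and degeneracy
   into applications of Fubini's theorem. *)
Require Import Defs.
From HB Require Import structures.
From mathcomp Require Import all_boot all_order all_algebra.
From mathcomp Require Import all_classical all_reals all_analysis.
From mathcomp Require Import measurable_realfun perm zify ring lra.
Set Implicit Arguments. Unset Strict Implicit. Unset Printing Implicit Defensive.
Import Order.TTheory GRing.Theory Num.Theory.
Import numFieldNormedType.Exports.
Local Open Scope classical_set_scope.
Local Open Scope ring_scope.

(** * Integrals of real-valued functions *)

(** Only third moments of the summands are available, and this shapes the error terms. Splitting a
    product by [2 a b <= a^2 + b^2] squares both the displacement of the intermediate point and the
    Gaussian approximation error, which would produce fourth moments and [beta^2]. Both quantities
    are therefore capped by a trivial bound beforehand: the square of a capped quantity is bounded
    linearly, by a multiple of the [|L_i|] in one case and by [beta] in the other. The remaining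
    factor [n^(-p)] is matched by the number of sets [A] of size [p], at most [n^p]. Comparing
    [f^(p+1)] with its Gaussian mean takes three more derivatives, which for [p = k] gives the order
    [k + 4]. Since [f] and [f'] may be unbounded, integrability comes from quadratic growth of [f]
    and from the Lipschitz property of [f']. No Gaussian variables are adjoined to the sample:
    replaced summands survive only as a Gaussian average inside the test function. Finally, only the
    total [T] is known to be square integrable; for each [T_A] this has to be derived from
    degeneracy before orthogonality makes sense. *)

Definition intg d (T : measurableType d) (R : realType)
  (mu : {measure set T -> \bar R}) (f : T -> R) : Prop :=
  mu.-integrable [set: T] (EFin \o f).

Definition sqint d (T : measurableType d) (R : realType)
  (mu : {measure set T -> \bar R}) (f : T -> R) : Prop :=
  measurable_fun [set: T] f /\ intg mu (fun x => f x ^+ 2).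

Section expectation.
Context d (T : measurableType d) (R : realType).
Implicit Types (mu : {measure set T -> \bar R}) (P : probability T R) (f g : T -> R).

Lemma intg_measurable mu f : intg mu f -> measurable_fun [set: T] f.
Proof. by case/integrableP => mf _; apply/measurable_EFinP. Qed.

Lemma eq_intg mu f g : f =1 g -> intg mu f -> intg mu g.
Proof. by move=> /funext ->. Qed.

Lemma intgD mu f g : intg mu f -> intg mu g -> intg mu (fun x => f x + g x).
Proof. by move=> If Ig; apply: eq_integrable (integrableD measurableT If Ig). Qed.

Lemma intgN mu f : intg mu f -> intg mu (fun x => - f x).
Proof. by move=> If; apply: eq_integrable (integrableN If). Qed.

Lemma intgB mu f g : intg mu f -> intg mu g -> intg mu (fun x => f x - g x).
Proof. by move=> If Ig; apply: intgD => //; exact: intgN. Qed.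

Lemma intgZ mu f (c : R) : intg mu f -> intg mu (fun x => c * f x).
Proof. by move=> If; apply: eq_integrable (integrableZl measurableT c If). Qed.

Lemma intg_sum mu (I : Type) (s : seq I) (Q : pred I) (F : I -> T -> R) :
  (forall i, Q i -> intg mu (F i)) -> intg mu (fun x => \sum_(i <- s | Q i) F i x).
Proof.
move=> IF.
apply: eq_integrable (integrable_sum measurableT s (P := Q)
  (h := fun i => EFin \o F i) IF) => //.
by move=> x _ /=; rewrite sumEFin.
Qed.

Lemma intg_le mu f g : measurable_fun [set: T] f -> (forall x, `|f x| <= g x) ->
  intg mu g -> intg mu f.
Proof.
move=> mf fg Ig; apply: le_integrable Ig => //; first exact/measurable_EFinP.
by move=> x _ /=; rewrite lee_fin (le_trans (fg x))// ler_norm.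
Qed.

Lemma intg_norm mu f : intg mu f -> intg mu (fun x => `|f x|).
Proof. by move=> If; exact: integrable_norm. Qed.

Lemma intg_cst P (c : R) : intg P (fun=> c).
Proof. exact: finite_measure_integrable_cst. Qed.

Lemma intg_bounded P f (M : R) : measurable_fun [set: T] f ->
  (forall x, `|f x| <= M) -> intg P f.
Proof. by move=> mf fM; apply: (intg_le mf fM); exact: intg_cst. Qed.

Lemma intgMb mu f g (M : R) : intg mu f -> measurable_fun [set: T] g ->
  (forall x, `|g x| <= M) -> intg mu (fun x => f x * g x).
Proof.
move=> If mg gM; apply: (@intg_le mu _ (fun x => M * `|f x|)).
- by apply: measurable_funM => //; exact: intg_measurable If.
- by move=> x; rewrite normrM mulrC ler_wpM2r.
- by apply: intgZ; exact: intg_norm.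
Qed.

Lemma RintD mu f g : intg mu f -> intg mu g ->
  \int[mu]_x (f x + g x) = \int[mu]_x f x + \int[mu]_x g x.
Proof. exact: RintegralD. Qed.

Lemma RintB mu f g : intg mu f -> intg mu g ->
  \int[mu]_x (f x - g x) = \int[mu]_x f x - \int[mu]_x g x.
Proof. exact: RintegralB. Qed.

Lemma RintZ mu f (c : R) : intg mu f ->
  \int[mu]_x (c * f x) = c * \int[mu]_x f x.
Proof. exact: RintegralZl. Qed.

Lemma Rint_sum mu (I : Type) (s : seq I) (Q : pred I) (F : I -> T -> R) :
  (forall i, Q i -> intg mu (F i)) ->
  \int[mu]_x (\sum_(i <- s | Q i) F i x) = \sum_(i <- s | Q i) \int[mu]_x F i x.
Proof.
move=> IF; elim: s => [|a s IH].
  rewrite big_nil; under eq_Rintegral do rewrite big_nil.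
  by rewrite Rintegral_cst// mul0r.
rewrite big_cons; under eq_Rintegral do rewrite big_cons.
case: ifPn => Qa //; rewrite RintD ?IH//; first exact: IF.
exact: intg_sum.
Qed.

Lemma Rint_cst P (c : R) : \int[P]_x c = c.
Proof. by rewrite Rintegral_cst// [X in fine X](probability_setT P) mulr1. Qed.

Lemma Rint_le mu f g : intg mu f -> intg mu g -> (forall x, f x <= g x) ->
  \int[mu]_x f x <= \int[mu]_x g x.
Proof. by move=> If Ig fg; apply: le_Rintegral. Qed.

Lemma Rint_abs_le mu f g : measurable_fun [set: T] f -> intg mu g ->
  (forall x, `|f x| <= g x) -> `|\int[mu]_x f x| <= \int[mu]_x g x.
Proof.
move=> mf Ig fg; have If := intg_le mf fg Ig.
apply: (le_trans (le_normr_Rintegral _ _)) => //.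
by apply: Rint_le => //; exact: intg_norm.
Qed.

Lemma EFin_Rint mu f : intg mu f -> (\int[mu]_x f x)%:E = (\int[mu]_x (f x)%:E)%E.
Proof.
by move=> If; rewrite /Rintegral fineK//; exact: integrable_fin_num.
Qed.

Lemma intgM mu f g : sqint mu f -> sqint mu g -> intg mu (fun x => f x * g x).
Proof.
move=> [mf If] [mg Ig]; apply: intg_le (intgD If Ig).
  exact: measurable_funM.
move=> x; rewrite normrM -[f x ^+ 2]real_normK ?num_real//.
rewrite -[g x ^+ 2]real_normK ?num_real//.
have := sqr_ge0 (`|f x| - `|g x|); have := normr_ge0 (f x).
have := normr_ge0 (g x); nra.
Qed.

Lemma sqintD mu f g : sqint mu f -> sqint mu g -> sqint mu (fun x => f x + g x).
Proof.
move=> sf sg; split; first exact: measurable_funD sf.1 sg.1.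
apply: (@intg_le mu _ (fun x => 2 * (f x ^+ 2 + g x ^+ 2))).
- by apply: measurable_funX; exact: measurable_funD sf.1 sg.1.
- by move=> x; rewrite ger0_norm ?sqr_ge0//; have := sqr_ge0 (f x - g x); nra.
- by apply: intgZ; exact: intgD sf.2 sg.2.
Qed.

Lemma sqintZ mu f (c : R) : sqint mu f -> sqint mu (fun x => c * f x).
Proof.
move=> sf; split; first by apply: measurable_funM => //; exact: sf.1.
by under eq_fun do rewrite exprMn; apply: intgZ; exact: sf.2.
Qed.

Lemma sqintB mu f g : sqint mu f -> sqint mu g -> sqint mu (fun x => f x - g x).
Proof.
move=> sf sg; under eq_fun do rewrite -[- g _]mulN1r.
by apply: sqintD => //; exact: sqintZ.
Qed.

Lemma sqint_cst P (c : R) : sqint P (fun=> c).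
Proof. by split; [exact: measurable_cst|exact: (intg_cst P (c ^+ 2))]. Qed.

Lemma sqint_sum P (I : Type) (s : seq I) (Q : pred I) (F : I -> T -> R) :
  (forall i, Q i -> sqint P (F i)) -> sqint P (fun x => \sum_(i <- s | Q i) F i x).
Proof.
move=> IF; elim: s => [|a s IH].
  have -> : (fun x => \sum_(i <- [::] | Q i) F i x) = fun=> 0.
    by apply/funext => x; rewrite big_nil.
  exact: sqint_cst.
have -> : (fun x => \sum_(i <- a :: s | Q i) F i x) =
    fun x => (if Q a then F a x else 0) + \sum_(i <- s | Q i) F i x.
  by apply/funext => x; rewrite big_cons; case: ifP; rewrite ?add0r.
by apply: sqintD => //; case: (boolP (Q a)) => Qa; [exact: IF|exact: sqint_cst].
Qed.

Lemma sqint_intg P f : sqint P f -> intg P f.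
Proof.
move=> sf; have := intgM sf (sqint_cst P 1).
by under eq_fun do rewrite mulr1.
Qed.

Lemma sqint_le mu f g : measurable_fun [set: T] f -> (forall x, `|f x| <= `|g x|) ->
  sqint mu g -> sqint mu f.
Proof.
move=> mf fg [mg Ig]; split=> //; apply: intg_le Ig; first exact: measurable_funX.
move=> x; rewrite normrX -[g x ^+ 2]real_normK ?num_real//.
by rewrite lerXn2r ?nnegrE.
Qed.

Lemma sqint_lip P (g : R -> R) (f : T -> R) (K : R) : continuous g ->
  (forall x y, `|g x - g y| <= K * `|x - y|) ->
  sqint P f -> sqint P (fun x => g (f x)).
Proof.
move=> cg gK sf; have mgf : measurable_fun [set: T] (fun x => g (f x)).
  apply: measurableT_comp; last exact: sf.1.
  exact: continuous_measurable_fun.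
apply: (@sqint_le _ _ (fun x => `|g 0| + K * `|f x|)) => //.
  move=> x; apply: le_trans (ler_norm _).
  have := gK (f x) 0; rewrite subr0 => h.
  have := ler_normD (g 0) (g (f x) - g 0); rewrite addrC subrK => h2.
  by apply: (le_trans h2); rewrite lerD2l.
apply: sqintD; first exact: sqint_cst.
apply: sqintZ; split; first by apply: measurableT_comp => //; exact: sf.1.
by under eq_fun do rewrite real_normK ?num_real//; exact: sf.2.
Qed.

(** The truncated squares increase to [f ^+ 2], so monotone convergence turns a bound uniform in the
    truncation level into integrability. This serves where finiteness of the second moment is the
    point to be proved. *)
Lemma Rint_sqr_fatou mu f (C : R) : measurable_fun [set: T] f ->
  (forall m : nat, intg mu (fun x => f x ^+ 2 * \1_[set y | `|f y| <= m%:R] x) /\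
   \int[mu]_x (f x ^+ 2 * \1_[set y | `|f y| <= m%:R] x) <= C) ->
  intg mu (fun x => f x ^+ 2).
Proof.
move=> mf fC; pose h (m : nat) x := (f x ^+ 2 * \1_[set y | `|f y| <= m%:R] x)%:E.
have mh m : measurable_fun [set: T] (h m).
  apply/measurable_EFinP; exact: intg_measurable (fC m).1.
have h0 m x : [set: T] x -> (0 <= h m x)%E.
  by move=> _; rewrite lee_fin mulr_ge0// ?sqr_ge0//.
have ndh x : [set: T] x -> {homo h ^~ x : a b / (a <= b)%N >-> (a <= b)%E}.
  move=> _ a b ab; rewrite lee_fin ler_wpM2l ?sqr_ge0//.
  rewrite !indicE ler_nat; case: (boolP (_ \in [set y | `|f y| <= a%:R])) => //.
  rewrite inE /= => fa; suff -> : (x \in [set y | `|f y| <= b%:R]) by [].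
  by rewrite inE /= (le_trans fa)// ler_nat.
have lh x : (limn (h ^~ x) = (f x ^+ 2)%:E)%E.
  apply: cvg_lim => //; apply: cvg_near_cst.
  (* From this level on the truncation is inactive at [x], so the sequence is eventually
     constant. *)
  exists (Num.trunc `|f x|).+1 => // m /= hm.
  rewrite /h indicE; suff -> : (x \in [set y | `|f y| <= m%:R]) by rewrite mulr1.
  rewrite inE /=; apply: le_trans (_ : (Num.trunc `|f x|).+1%:R <= _).
    by apply: ltW; rewrite truncnS_gt.
  by rewrite ler_nat.
apply/integrableP; split; first by apply/measurable_EFinP; exact: measurable_funX.
under eq_integral do rewrite /= ger0_norm ?sqr_ge0// -lh.
rewrite (monotone_convergence _ measurableT mh h0 ndh).
apply: (@le_lt_trans _ _ C%:E); last exact: ltry.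
apply: lime_le.
  apply: ereal_nondecreasing_is_cvgn => a b ab.
  by apply: ge0_le_integral => // x xT; [exact: h0|exact: ndh].
near=> m; rewrite -EFin_Rint; last exact: (fC m).1.
rewrite lee_fin; exact: (fC m).2.
Unshelve. all: by end_near. Qed.

End expectation.

(** * Laws of independent identically distributed coordinates *)

Section transport.
Context d1 d2 (T1 : measurableType d1) (T2 : measurableType d2) (R : realType).
Variables (m1 : {measure set T1 -> \bar R}) (m2 : {measure set T2 -> \bar R}).
Variable f : T1 -> T2.
Hypothesis mf : measurable_fun [set: T1] f.
Hypothesis m12 : forall B, measurable B -> m1 (f @^-1` B) = m2 B.

(** [m2] is compared with the image of [m1] only on measurable sets. In this form the change of
    variables serves permutations, merged samples, single coordinates and the sample vector
    alike. *)
Lemma ge0_integral_transport (F : T2 -> \bar R) : measurable_fun [set: T2] F ->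
  (forall x, 0 <= F x)%E -> (\int[m2]_x F x = \int[m1]_x F (f x))%E.
Proof.
move=> mF F0.
rewrite (_ : (\int[m1]_x F (f x))%E = (\int[pushforward m1 f]_x F x)%E).
  by apply: eq_measure_integral => B mB _; rewrite /= /pushforward m12.
by rewrite ge0_integral_pushforward//.
Qed.

Lemma intg_transport (F : T2 -> R) : measurable_fun [set: T2] F ->
  intg m1 (F \o f) <-> intg m2 F.
Proof.
move=> mF; have mEF : measurable_fun [set: T2] (EFin \o F) by exact/measurable_EFinP.
have mA : measurable_fun [set: T2] (fun x => `|(F x)%:E|)%E by exact: measurableT_comp.
have e := @ge0_integral_transport (fun x => `|(F x)%:E|)%E mA (fun=> abse_ge0 _).
split=> [/integrableP[_ H]|/integrableP[_ H]]; apply/integrableP; split => //.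
- by rewrite e.
- by apply/measurable_EFinP; exact: measurableT_comp.
- by rewrite -[X in (X < _)%E]e.
Qed.

Lemma Rint_transport (F : T2 -> R) : intg m2 F -> \int[m1]_x F (f x) = \int[m2]_x F x.
Proof.
move=> IF; have mF := intg_measurable IF.
have IFf : intg m1 (F \o f) by exact/intg_transport.
rewrite /Rintegral; congr fine; apply/esym.
rewrite (_ : (\int[m1]_x (F (f x))%:E)%E = (\int[pushforward m1 f]_x (F x)%:E)%E).
  by apply: eq_measure_integral => B mB _; rewrite /= /pushforward m12.
by rewrite integral_pushforward//; exact/measurable_EFinP.
Qed.

End transport.

Section tensor.
Context d1 d2 (T1 : measurableType d1) (T2 : measurableType d2) (R : realType).
Variables (P1 : probability T1 R) (P2 : probability T2 R).

Lemma intg_tensor (U : T1 -> R) (V : T2 -> R) : intg P1 U -> intg P2 V ->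
  intg (P1 \x P2)%E (fun z => U z.1 * V z.2).
Proof.
move=> IU IV; have mU := intg_measurable IU; have mV := intg_measurable IV.
apply/integrable12ltyP.
  apply/measurable_EFinP; apply: measurable_funM; exact: measurableT_comp.
under eq_integral => x _.
  under eq_integral => y _ do rewrite /= normrM EFinM.
  rewrite ge0_integralZl//; last by apply/measurable_EFinP; exact: measurableT_comp.
  over.
have /integrableP[_ hV] := IV; have /integrableP[_ hU] := IU.
have fV : (\int[P2]_y `|V y|%:E)%E \is a fin_num.
  by rewrite ge0_fin_numE//; apply: integral_ge0 => y _.
rewrite -(fineK fV) ge0_integralZr//; last 2 first.
- by apply/measurable_EFinP; exact: measurableT_comp.
- by rewrite lee_fin fine_ge0//; apply: integral_ge0 => y _.
apply: lte_mul_pinfty.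
- by apply: integral_ge0 => y _.
- by rewrite ge0_fin_numE//; apply: integral_ge0 => y _.
- exact: ltry.
Qed.

Lemma Rint_prod (F : T1 * T2 -> R) : intg (P1 \x P2)%E F ->
  \int[(P1 \x P2)%E]_z F z = fine (\int[P1]_x \int[P2]_y (F (x, y))%:E)%E.
Proof. by move=> IF; rewrite /Rintegral -integral12_prod_meas1. Qed.

Lemma Rint_tensor (U : T1 -> R) (V : T2 -> R) : intg P1 U -> intg P2 V ->
  \int[(P1 \x P2)%E]_z (U z.1 * V z.2) = \int[P1]_x U x * \int[P2]_x V x.
Proof.
move=> IU IV; rewrite Rint_prod; last exact: intg_tensor.
under eq_integral => x _.
  under eq_integral => y _ do rewrite /= EFinM.
  rewrite integralZl// -EFin_Rint// -EFinM mulrC.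
  over.
by rewrite /= -/(Rintegral P1 setT (fun x => _ * U x)) RintZ// mulrC.
Qed.

End tensor.

(** The generating family is the one in [borel_fun_p], so a Borel function of [p] variables is,
    after unfolding, a measurable function on [space R p]. *)
Definition space (R : realType) (n : nat) := g_sigma_algebraType (@cylinders R n).

Section space.
Context {R : realType} {n : nat}.
Local Notation E := (space R n).

Lemma measurable_coord (i : 'I_n) : measurable_fun [set: E] (fun x : E => x i).
Proof.
move=> _ B mB; rewrite setTI; apply: sub_sigma_algebra.
by exists i, B.
Qed.

Lemma measurable_to_space d (T : measurableType d) (f : T -> E) :
  (forall i, measurable_fun [set: T] (fun w => f w i)) -> measurable_fun [set: T] f.
Proof.
move=> mf; apply: (@measurability _ _ T E setT f (@cylinders R n)) => //.
move=> _ [_ [i [B [mB ->]] <-]].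
have := mf i measurableT B mB.
by congr (measurable _); apply/seteqP; split => w [].
Qed.

Definition rect (B : 'I_n -> set R) : set E := [set x | forall i, B i (x i)].

Lemma measurable_rect B : (forall i, measurable (B i)) -> measurable (rect B).
Proof.
move=> mB; rewrite (_ : rect B = \bigcap_(i in [set: 'I_n]) ((fun x : E => x i) @^-1` B i)).
  apply: fin_bigcap_measurable => // i _.
  by have := measurable_coord i measurableT (mB i); rewrite setTI; exact.
by apply/seteqP; split => [x h i _|x h i]; [exact: h|exact: (h i I)].
Qed.

Definition iid_law (mu : set E -> \bar R) (nu : probability R R) :=
  forall B, (forall i, measurable (B i)) ->
    mu (rect B) = \big[*%E/1%E]_(i < n) nu (B i).

(** Rectangles are stable under intersection and generate the sigma-algebra, since a cylinder is a
    rectangle whose other sides are the whole line; the whole space is a rectangle of mass 1. *)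
Lemma iid_law_unique (m1 m2 : {measure set E -> \bar R}) nu :
  iid_law m1 nu -> iid_law m2 nu -> forall A, measurable A -> m1 A = m2 A.
Proof.
move=> h1 h2.
pose G : set (set E) := [set A | exists B, (forall i, measurable (B i)) /\ A = rect B].
have rectT : rect (fun=> setT) = setT by apply/seteqP; split.
apply: (measure_unique G (fun=> setT)).
- apply/seteqP; split.
    apply: smallest_sub; first exact: smallest_sigma_algebra.
    move=> _ [i [B [mB ->]]]; apply: sub_gen_smallest.
    exists (fun j => if j == i then B else setT); split.
      by move=> j; case: ifP.
    apply/seteqP; split => [x /= Bx j|x /= /(_ i)]; last by rewrite eqxx.
    by case: eqP => [->|].
  apply: smallest_sub; first exact: sigma_algebra_measurable.
  by move=> _ [B [mB ->]]; exact: measurable_rect.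
- move=> _ _ [B [mB ->]] [C [mC ->]]; exists (fun i => B i `&` C i); split.
    by move=> i; exact: measurableI.
  apply/seteqP; split => [x [hB hC] i|x h]; first by split; [exact: hB|exact: hC].
  by split=> i; have [] := h i.
- by move=> _; exists (fun=> setT); rewrite rectT.
- by rewrite bigcup_const.
- by move=> _ [B [mB ->]]; rewrite h1// h2.
- by move=> _; rewrite -rectT h1// big1 ?ltry// => i _; exact: probability_setT.
Qed.

Definition merge (A : {set 'I_n}) (z : E * E) : E :=
  fun i => if i \in A then z.1 i else z.2 i.

Definition permute (s : {perm 'I_n}) (x : E) : E := fun i => x (s i).

Lemma measurable_merge A : measurable_fun [set: E * E] (merge A).
Proof.
apply: measurable_to_space => i; rewrite /merge; case: (i \in A).
  by apply: (measurableT_comp (@measurable_coord i)).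
by apply: (measurableT_comp (@measurable_coord i)).
Qed.

Lemma measurable_permute s : measurable_fun [set: E] (permute s).
Proof. by apply: measurable_to_space => i; exact: measurable_coord. Qed.

Section invariance.
Variables (mu : probability E R) (nu : probability R R).
Hypothesis iid : iid_law mu nu.

Lemma permute_law s B : measurable B -> mu (permute s @^-1` B) = mu B.
Proof.
apply: (@iid_law_unique (pushforward mu (permute s)) _ nu _ iid) => //.
  exact: measurable_permute.
move=> ms C mC; rewrite /= /pushforward.
rewrite (_ : _ @^-1` _ = rect (fun j => C (s^-1 j)%g)).
  by rewrite iid// (reindex_inj (@perm_inj _ s))/=; under eq_bigr do rewrite permK.
apply/seteqP; split => [x h j|x h i]; last by have := h (s i); rewrite permK.
by have := h (s^-1 j)%g; rewrite /permute permKV.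
Qed.

Lemma merge_law A B : measurable B -> (mu \x mu)%E (merge A @^-1` B) = mu B.
Proof.
apply: (@iid_law_unique (pushforward (mu \x mu)%E (merge A)) _ nu _ iid) => //.
  exact: measurable_merge.
move=> ms C mC; rewrite /= /pushforward.
pose C1 i := if i \in A then C i else setT.
pose C2 i := if i \in A then setT else C i.
have mC1 i : measurable (C1 i) by rewrite /C1; case: ifP.
have mC2 i : measurable (C2 i) by rewrite /C2; case: ifP.
rewrite (_ : _ @^-1` _ = rect C1 `*` rect C2).
  transitivity (mu (rect C1) * mu (rect C2))%E.
    by apply: product_measure1E; exact: measurable_rect.
  rewrite (iid mC1) (iid mC2) -big_split/=; apply: eq_bigr => i _.
  by rewrite /C1 /C2; case: ifP; rewrite probability_setT ?mule1 ?mul1e.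
apply/seteqP; split => [[x y] h|[x y] [/= h1 h2] i].
  split=> i /=; have := h i; rewrite /merge /C1 /C2 /=; case: ifP => //.
by have := h1 i; have := h2 i; rewrite /merge /C1 /C2 /=; case: ifP.
Qed.

Lemma intg_permute s (F : E -> R) : intg mu F -> intg mu (F \o permute s).
Proof.
move=> IF; apply/(intg_transport (@measurable_permute s) (@permute_law s)) => //.
exact: intg_measurable IF.
Qed.

Lemma Rint_permute s (F : E -> R) : intg mu F ->
  \int[mu]_x F (permute s x) = \int[mu]_x F x.
Proof.
exact: (Rint_transport (@measurable_permute s) (@permute_law s)).
Qed.

Lemma intg_merge A (F : E -> R) : measurable_fun [set: E] F ->
  intg (mu \x mu)%E (F \o merge A) <-> intg mu F.
Proof. exact: (intg_transport (@measurable_merge A) (@merge_law A)). Qed.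

Lemma Rint_merge A (F : E -> R) : intg mu F ->
  \int[(mu \x mu)%E]_z F (merge A z) = \int[mu]_x F x.
Proof. exact: (Rint_transport (@measurable_merge A) (@merge_law A)). Qed.

Definition depends_on (A : {set 'I_n}) (Z : Type) (F : E -> Z) :=
  forall x y : E, {in A, forall i, x i = y i} -> F x = F y.

Lemma depends_onS (A B : {set 'I_n}) (Z : Type) (F : E -> Z) : A \subset B ->
  depends_on A F -> depends_on B F.
Proof. by move=> /fintype.subsetP AB h x y xy; apply: h => i /AB; exact: xy. Qed.

(** After merging along [A], [U] sees only the first sample and [V] only the second, so their
    product becomes a tensor product on two independent copies. *)
Lemma indep_intg (A B : {set 'I_n}) (U V : E -> R) : {in A, forall i, i \notin B} ->
  depends_on A U -> depends_on B V -> intg mu U -> intg mu V ->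
  intg mu (fun x => U x * V x) /\
  \int[mu]_x (U x * V x) = \int[mu]_x U x * \int[mu]_x V x.
Proof.
move=> AB dU dV IU IV.
have e : (fun x => U x * V x) \o merge A = fun z => U z.1 * V z.2.
  apply/funext => z /=; congr (_ * _).
    by apply: dU => i iA; rewrite /merge iA.
  by apply: dV => i iB; rewrite /merge ifN//; apply/negP => /AB; rewrite iB.
have mUV : measurable_fun [set: E] (fun x => U x * V x).
  by apply: measurable_funM; [exact: intg_measurable IU|exact: intg_measurable IV].
have I : intg mu (fun x => U x * V x).
  by apply/(intg_merge A mUV); rewrite e; exact: intg_tensor.
split=> //; rewrite -(Rint_merge A I) -Rint_tensor//.
by apply: eq_Rintegral => z _; rewrite -[RHS](congr1 (@^~ z) e).
Qed.

End invariance.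
End space.

(** * Degeneracy *)

Section iterated.
Context d1 d2 (T1 : measurableType d1) (T2 : measurableType d2) (R : realType).
Variables (P1 : probability T1 R) (P2 : probability T2 R).

(** The real-valued inner integral replaces infinite values by 0; Fubini confines this change to a
    null set. *)
Lemma Rint_prod_iter (F : T1 * T2 -> R) : intg (P1 \x P2)%E F ->
  intg P1 (fun x => \int[P2]_y F (x, y)) /\
  \int[(P1 \x P2)%E]_z F z = \int[P1]_x \int[P2]_y F (x, y).
Proof.
move=> IF; have I1 := integrable_fubini_F IF.
have mf1 := measurable_int _ I1.
have I2 : intg P1 (fun x => \int[P2]_y F (x, y)).
  apply: (le_integrable measurableT _ _ I1).
    by apply/measurable_EFinP; apply: measurableT_comp mf1.
  move=> x _ /=; rewrite /Rintegral /fubini_F.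
  case: (\int[P2]_y _)%E => [r| |] //=; exact: leey.
split => //; rewrite Rint_prod// [RHS]/Rintegral; congr fine.
apply: ae_eq_integral => //.
- by have /measurable_EFinP := intg_measurable I2.
- have := integrable_ae measurableT I1.
  apply: filterS => x h _ /=; rewrite /Rintegral fineK//; exact: h.
Qed.

Lemma intg_section (F : T1 * T2 -> R) : intg (P1 \x P2)%E F ->
  {ae P1, forall x, intg P2 (fun y => F (x, y))}.
Proof.
by move=> IF; have := ae_integrable1 IF; apply: filterS => x h.
Qed.

Lemma Rint_ae0 (f : T1 -> R) : intg P1 f -> {ae P1, forall x, f x = 0} ->
  \int[P1]_x f x = 0.
Proof.
move=> If f0; rewrite /Rintegral (_ : (\int[P1]_x (f x)%:E)%E = 0%E)//.
rewrite -(@integral0 _ _ _ P1 [set: T1]); apply: ae_eq_integral => //.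
- by have /integrableP[] := If.
- by apply: filterS f0 => x h _; rewrite h.
Qed.

Lemma Rint_abs0 (f : T1 -> R) : intg P1 f -> \int[P1]_x `|f x| = 0 ->
  {ae P1, forall x, f x = 0}.
Proof.
move=> If f0; have mf : measurable_fun [set: T1] (EFin \o f) by case/integrableP : If.
have h : (\int[P1]_(x in [set: T1]) `|(EFin \o f) x| = 0)%E.
  by rewrite -[RHS](congr1 EFin f0) EFin_Rint//; exact: intg_norm.
have /(_ h) := (ae_eq_integral_abs P1 measurableT mf).1.
by apply: filterS => x /(_ I) [].
Qed.

End iterated.

Section degenerate.
Context {R : realType} {n : nat}.
Local Notation E := (space R n).
Variables (mu : probability E R) (nu : probability R R).
Hypothesis iid : iid_law mu nu.

Lemma merge_depends (A : {set 'I_n}) (Z : Type) (F : E -> Z) (x y : E) :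
  depends_on A F -> F (merge A (x, y)) = F x.
Proof. by move=> dF; apply: dF => i iA; rewrite /merge iA. Qed.

(** Integrating out coordinate [i] alone gives a concrete version [tau] of the conditional
    expectation of [F]. It vanishes almost everywhere, and Fubini then takes [U], constant along
    that coordinate, out of the inner integral. Only the product [F * U] has to be integrable. *)
Lemma degenerate_orth (A : {set 'I_n}) (i : 'I_n) (F U : E -> R) :
  intg mu F -> depends_on A F ->
  (forall D : set E, measurable D -> depends_on (A :\ i)%SET D ->
     \int[mu]_x (F x * \1_D x) = 0) ->
  depends_on (~: [set i])%SET U ->
  intg mu (fun x => F x * U x) -> \int[mu]_x (F x * U x) = 0.
Proof.
move=> IF dF F0 dU IFU; pose M : E * E -> E := merge (~: [set i])%SET.
have mF := intg_measurable IF.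
have IFM : intg (mu \x mu)%E (F \o M) by apply/(intg_merge iid _ mF).
(* [M (x, y)] is [x] with coordinate [i] resampled from [y]. *)
pose tau x := \int[mu]_y F (M (x, y)).
have [Itau _] := Rint_prod_iter IFM.
have mtau := intg_measurable Itau.
have dtau : depends_on (A :\ i)%SET tau.
  move=> x x' xx'; apply: eq_Rintegral => y _; apply: dF => j jA.
  rewrite /M /merge !inE; case: (eqVneq j i) => //= ji.
  by apply: xx'; rewrite !inE ji.
have tau_ind D : measurable D -> depends_on (A :\ i)%SET D ->
    intg mu (fun x => tau x * \1_D x) /\ \int[mu]_x (tau x * \1_D x) = 0.
  move=> mD dD.
  have ind1 x : `|\1_D x| <= 1 :> R.
    by rewrite indicE; case: (_ \in _) => /=; rewrite ?normr1 ?normr0.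
  have mI : measurable_fun [set: E] (\1_D : E -> R) by exact: measurable_indic.
  split; first exact: (intgMb Itau mI ind1).
  have IFD : intg mu (fun x => F x * \1_D x) := intgMb IF mI ind1.
  rewrite -[RHS](F0 D mD dD) -(Rint_merge iid (~: [set i])%SET IFD).
  have IM : intg (mu \x mu)%E (fun z => F (M z) * \1_D (M z)).
    by apply/(intg_merge iid (~: [set i])%SET (intg_measurable IFD)).
  rewrite (Rint_prod_iter IM).2; apply: eq_Rintegral => x _.
  have e y : \1_D (M (x, y)) = \1_D x :> R.
    rewrite !indicE; congr (_%:R); congr (nat_of_bool _); apply/idP/idP; rewrite !inE;
      rewrite (_ : D (M (x, y)) = D x)//; apply: dD => j;
      by rewrite !inE => /andP[ji _]; rewrite /M /merge !inE ji.
  under [RHS]eq_Rintegral do rewrite e.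
  rewrite indicE; case: (x \in D).
    by rewrite mulr1; apply: eq_Rintegral => y _; rewrite mulr1.
  by rewrite mulr0; under eq_Rintegral do rewrite mulr0; rewrite Rint_cst.
have tau0 : {ae mu, forall x, tau x = 0}.
  apply: Rint_abs0 => //.
  (* The sign sets of [tau] depend only on [A :\ i], hence are admissible tests; together they
     recover the integral of [|tau|]. *)
  pose Dp := [set x | 0 < tau x]; pose Dn := [set x | tau x < 0].
  have mDp : measurable Dp.
    by rewrite -[Dp]setTI; apply: measurable_fun_ltr.
  have mDn : measurable Dn.
    by rewrite -[Dn]setTI; apply: measurable_fun_ltr.
  have dDp : depends_on (A :\ i)%SET Dp by move=> x y xy; rewrite /Dp /= (dtau _ _ xy).
  have dDn : depends_on (A :\ i)%SET Dn by move=> x y xy; rewrite /Dn /= (dtau _ _ xy).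
  have [Ip ep] := tau_ind _ mDp dDp; have [In en] := tau_ind _ mDn dDn.
  transitivity (\int[mu]_x (tau x * \1_Dp x - tau x * \1_Dn x)).
    apply: eq_Rintegral => x _; rewrite !indicE.
    case: (ltgtP (tau x) 0) => tx.
    - rewrite (_ : x \in Dp = false); last by apply/negP; rewrite inE /Dp /= ltNge ltW.
      have -> : (x \in Dn) = true by exact: mem_set.
      by rewrite /= mulr0n mulr1n mulr0 mulr1 ltr0_norm// sub0r.
    - rewrite (_ : x \in Dn = false); last by apply/negP; rewrite inE /Dn /= ltNge ltW.
      have -> : (x \in Dp) = true by exact: mem_set.
      by rewrite /= mulr0n mulr1n mulr0 mulr1 gtr0_norm// subr0.
    - by rewrite tx normr0 !mul0r subr0.
  by rewrite RintB// ep en subr0.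
rewrite -(Rint_merge iid (~: [set i])%SET IFU) -/M.
have IM : intg (mu \x mu)%E (fun z => F (M z) * U (M z)).
  by apply/(intg_merge iid (~: [set i])%SET (intg_measurable IFU)).
have [I1 ->] := Rint_prod_iter IM.
apply: Rint_ae0 => //.
apply: filterS2 tau0 (intg_section IFM) => x tx Ix.
under eq_Rintegral => y _ do rewrite (merge_depends _ _ dU) mulrC.
by rewrite RintZ// -/(tau x) tx mulr0.
Qed.

End degenerate.

(** * Symmetric statistics and relabelling of indices *)

Section statistic.
Context {R : realType} {n : nat}.
Local Notation E := (space R n).
Variable t : forall p : nat, ('I_p -> R) -> R.
Hypothesis t_borel : forall p, borel_fun_p (t (p := p)).
Hypothesis t_sym : forall p, symmetric_fun (t (p := p)).

Definition tA (A : {set 'I_n}) : E -> R := TA t (fun i (x : E) => x i) A.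

Lemma measurable_tA A : measurable_fun [set: E] (tA A).
Proof.
rewrite /tA /TA; apply: (@measurableT_comp _ _ _ E (space R #|A|) R (t (p := #|A|))).
  by move=> _ B mB; rewrite setTI; exact: t_borel.
by apply: measurable_to_space => i; exact: measurable_coord.
Qed.

Lemma depends_on_tA A : depends_on A (tA A).
Proof.
move=> x y xy; rewrite /tA /TA; congr (t _); apply/funext => i.
by apply: xy; exact: enum_valP.
Qed.

(** The two arities, the cardinals of a set and of its image, are equal only propositionally, so
    this equality is eliminated before anything else. Then [u] is [v] composed with an injective,
    hence bijective, self-map of ['I_p], which symmetry absorbs. *)
Lemma sym_reindex (p q : nat) (u : 'I_p -> 'I_n) (v : 'I_q -> 'I_n) (x : 'I_n -> R) :
  p = q -> injective u -> (forall i, exists j, v j = u i) ->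
  t (fun i => x (u i)) = t (fun j => x (v j)).
Proof.
move=> pq; case: q / pq v => v ui uv.
have /choice [f fE] : forall i, exists j, v j = u i by [].
have fi : injective f by move=> i j fij; apply: ui; rewrite -!fE fij.
rewrite -(t_sym (perm fi) (fun j => x (v j))); congr (t _); apply/funext => i.
by rewrite permE fE.
Qed.

Lemma tA_permute A s x : tA A (permute s x) = tA (s @: A)%SET x.
Proof.
rewrite /tA /TA /permute.
apply: (@sym_reindex _ _ (fun i => s (enum_val i)) (fun i => enum_val i) x).
- by rewrite card_imset//; exact: perm_inj.
- by move=> i j /perm_inj /enum_val_inj.
- move=> i; have h : s (enum_val i) \in (s @: A)%SET by rewrite imset_f// enum_valP.
  by exists (enum_rank_in h (s (enum_val i))); rewrite enum_rankK_in.
Qed.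

End statistic.

Definition initial_set (n p : nat) : {set 'I_n} := [set i : 'I_n | (i < p)%N]%SET.

Lemma card_initial_set n p : (p <= n)%N -> #|initial_set n p| = p.
Proof.
move=> pn; have wi : injective (widen_ord pn).
  by move=> a b /(congr1 val) /= /val_inj.
rewrite -[RHS]card_ord -(card_imset _ wi).
apply: eq_card => i; rewrite inE; apply/idP/imsetP => [ip|[j _ ->]].
  by exists (Ordinal ip) => //; exact: val_inj.
by rewrite /=.
Qed.

(** The degeneracy hypothesis integrates out the variable of index 0; sending [i] there makes it
    available for every variable in [A]. *)
Lemma perm_to_initial n (A : {set 'I_n}) (i : 'I_n) : i \in A ->
  exists s : {perm 'I_n}, (s @: A)%SET = initial_set n #|A| /\ s i = 0%N :> nat.
Proof.
(* The list runs through [i], the rest of [A], then the complement; the permutation sends each index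
   to its position in it. *)
move=> iA; pose l := i :: enum (A :\ i)%SET ++ enum (~: A)%SET.
have ul : uniq l.
  rewrite /= cat_uniq !enum_uniq mem_cat !mem_enum !inE eqxx iA /= andbT.
  apply/hasPn => j; rewrite !mem_enum !inE => /negPf ->; by rewrite andbF.
have memA j : j \in A -> j \in i :: enum (A :\ i)%SET.
  by move=> jA; rewrite inE mem_enum !inE jA andbT; case: eqP.
have meml j : j \in l.
  rewrite /l -cat_cons mem_cat; case: (boolP (j \in A)) => [/memA -> //|jA].
  by rewrite mem_enum finset.in_setC jA orbT.
have sl : size l = n.
  rewrite -[RHS]card_ord -(card_uniqP ul); apply: eq_card => j; by rewrite meml.
have lt j : (index j l < n)%N by rewrite -[X in (_ < X)%N]sl index_mem.
have fi : injective (fun j => Ordinal (lt j)).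
  by move=> j k [] /(congr1 (nth i l)); rewrite !nth_index.
have sA : size (i :: enum (A :\ i)%SET) = #|A| by rewrite /= -cardE [RHS](cardsD1 i) iA.
exists (perm fi); split; last by rewrite permE /= eqxx.
apply/eqP; rewrite eqEcard card_imset; last exact: perm_inj.
rewrite card_initial_set ?leqnn ?andbT; last by rewrite -[X in (_ <= X)%N]card_ord max_card.
apply/fintype.subsetP => _ /imsetP[j jA ->]; rewrite inE permE.
have e : index j l = index j (i :: enum (A :\ i)%SET).
  by rewrite /l -cat_cons index_cat memA.
by change (is_true (index j l < #|A|)%N); rewrite e -sA index_mem memA.
Qed.

Section degenerate_statistic.
Context {R : realType} {n k : nat}.
Local Notation E := (space R n).
Variables (mu : probability E R) (nu : probability R R).
Hypothesis iid : iid_law mu nu.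
Variable t : forall p : nat, ('I_p -> R) -> R.
Hypothesis t_sym : forall p, symmetric_fun (t (p := p)).
Hypothesis t_intg : forall p, (1 <= p <= k)%N -> (p <= n)%N ->
  intg mu (tA t (initial_set n p)).
Hypothesis t_deg : forall p, (1 <= p <= k)%N -> (p <= n)%N ->
  forall D : set E, measurable D ->
  depends_on [set j : 'I_n | (1 <= j < p)%N]%SET D ->
  \int[mu]_x (tA t (initial_set n p) x * \1_D x) = 0.
Local Notation tA := (tA t).
Implicit Types A B : {set 'I_n}.

Lemma card_le_n (A : {set 'I_n}) : (#|A| <= n)%N.
Proof. by rewrite -[X in (_ <= X)%N]card_ord max_card. Qed.

Lemma tA_intg A : (0 < #|A| <= k)%N -> intg mu (tA A).
Proof.
move=> Ak; have /card_gt0P[i iA] : (0 < #|A|)%N by case/andP: Ak.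
have [s [sA _]] := perm_to_initial iA.
have := intg_permute iid (s^-1)%g (t_intg Ak (card_le_n A)).
apply: eq_integrable => // x _ /=; rewrite tA_permute// -sA -imset_comp.
by rewrite (_ : _ \o _ = id) ?imset_id//; apply/funext => j /=; rewrite permK.
Qed.

Lemma tA_orth A i (U : E -> R) : (0 < #|A| <= k)%N -> i \in A ->
  depends_on (~: [set i])%SET U -> intg mu (fun x => tA A x * U x) ->
  \int[mu]_x (tA A x * U x) = 0.
Proof.
move=> Ak iA dU IU; have [s [sA si]] := perm_to_initial iA.
rewrite -(Rint_permute iid (s^-1)%g IU).
have e0 x : tA (initial_set n #|A|) x = tA A (permute s x) by rewrite tA_permute// sA.
have e1 x : tA A x = tA (initial_set n #|A|) (permute (s^-1)%g x).
  rewrite e0; congr (tA A _); apply/funext => j; rewrite /permute.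
  by rewrite permK.
rewrite (Rint_permute iid (s^-1)%g IU) -(Rint_permute iid s IU).
have IU' := intg_permute iid s IU.
under eq_Rintegral do rewrite -e0.
apply: (@degenerate_orth _ _ mu nu iid (initial_set n #|A|) (s i)).
- exact: t_intg (card_le_n A).
- exact: depends_on_tA.
- move=> D mD dD; apply: (t_deg Ak (card_le_n A)) => //.
  (* As [s i] is the index 0, removing it from the initial segment leaves exactly the indices
     allowed in [t_deg]. *)
  apply: depends_onS dD; apply/fintype.subsetP => j; rewrite !inE => /andP[ji ->].
  rewrite andbT lt0n; apply: contraNneq ji => j0.
  by apply/eqP/val_inj; rewrite /= j0 si.
- move=> x y xy; apply: dU => j; rewrite !inE => ji; apply: xy.
  by rewrite !inE; apply: contraNneq ji => /perm_inj ->.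
- apply: eq_integrable IU' => // x _ /=.
  by rewrite e0.
Qed.

Definition TE (x : E) : R := TT k t (fun i (x : E) => x i) x.

Lemma sum_by_card (V : nmodType) (F : {set 'I_n} -> V) :
  \sum_(1 <= p < k.+1) \sum_(A : {set 'I_n} | #|A| == p) F A =
  \sum_(A : {set 'I_n} | (0 < #|A| <= k)%N) F A.
Proof.
under eq_bigr do rewrite big_mkcond.
rewrite exchange_big/= [RHS]big_mkcond; apply: eq_bigr => A _.
rewrite -big_mkcond/=; under eq_bigl do rewrite eq_sym.
by rewrite big_nat1_eq ltnS.
Qed.

Lemma TE_sum x : TE x = \sum_(A : {set 'I_n} | (0 < #|A| <= k)%N) tA A x.
Proof. by rewrite -sum_by_card. Qed.

Lemma TE_intg : intg mu TE.
Proof.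
rewrite (_ : TE = fun x => \sum_(A : {set 'I_n} | (0 < #|A| <= k)%N) tA A x).
  by apply: intg_sum => A; exact: tA_intg.
by apply/funext => x; exact: TE_sum.
Qed.

Lemma Rint_tA0 A : (0 < #|A| <= k)%N -> \int[mu]_x tA A x = 0.
Proof.
move=> Ak; have /card_gt0P[i iA] : (0 < #|A|)%N by case/andP: Ak.
have := @tA_orth A i (fun=> 1) Ak iA; under eq_Rintegral do rewrite mulr1.
apply; first by [].
by apply: (eq_intg _ (tA_intg Ak)) => x; rewrite mulr1.
Qed.

Lemma Rint_TE0 : \int[mu]_x TE x = 0.
Proof.
under eq_Rintegral do rewrite TE_sum.
rewrite Rint_sum; first by apply: big1 => A; exact: Rint_tA0.
by move=> A; exact: tA_intg.
Qed.

Lemma exists_diff (A B : {set 'I_n}) : ~~ (B \subset A) -> exists2 i, i \in B & i \notin A.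
Proof. by case/subsetPn => i; exists i. Qed.

(** * Second moments and orthogonality of the components *)

Section square_integrable.
Hypothesis TE_sq : sqint mu TE.

Definition TY (A : {set 'I_n}) (x : E) : R :=
  \sum_(B : {set 'I_n} | (0 < #|B| <= k)%N && (B \subset A)) tA B x.

Lemma depends_on_TY A : depends_on A (TY A).
Proof.
move=> x y xy; apply: eq_bigr => B /andP[_ BA].
exact: (depends_onS BA (@depends_on_tA _ _ t B)).
Qed.

Lemma TY_intg A : intg mu (TY A).
Proof. by apply: intg_sum => B /andP[Bk _]; exact: tA_intg. Qed.

(* [TY A] plays the role of [E(TE | X_i, i in A)], so it inherits the second
   moment of [TE]; testing against truncations of [TY A] itself avoids
   conditional expectations. *)
Lemma TY_sqint A : sqint mu (TY A).
Proof.
have IY := TY_intg A; have mY := intg_measurable IY.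
split => //; apply: (@Rint_sqr_fatou _ _ _ mu _ (\int[mu]_x (TE x ^+ 2))) => // m.
pose Z x : R := TY A x * \1_[set y | `|TY A y| <= m%:R] x.
have mI : measurable [set y | `|TY A y| <= m%:R].
  rewrite -[X in measurable X]setTI; apply: measurable_fun_ler => //.
  exact: measurableT_comp.
have mZ : measurable_fun [set: E] Z.
  by apply: measurable_funM => //; exact: measurable_indic.
have Zm x : `|Z x| <= m%:R.
  rewrite /Z indicE; case: (boolP (x \in _)) => h; last by rewrite mulr0 normr0.
  by rewrite mulr1; move: h; rewrite inE.
have dZ : depends_on A Z.
  move=> x y xy; rewrite /Z (depends_on_TY xy) !indicE.
  by congr (_ * (nat_of_bool _)%:R); apply/idP/idP; rewrite !inE /= (depends_on_TY xy).
have Z2 x : TY A x ^+ 2 * \1_[set y | `|TY A y| <= m%:R] x = Z x ^+ 2.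
  rewrite /Z exprMn; congr (_ * _); rewrite indicE.
  by case: (x \in _); rewrite ?expr1n ?expr0n.
have YZ x : TY A x * Z x = Z x ^+ 2.
  by rewrite -Z2 /Z mulrA expr2.
have sZ : sqint mu Z.
  split => //; apply: (@intg_bounded _ _ _ mu _ (m%:R ^+ 2)); first exact: measurable_funX.
  by move=> x; rewrite normrX lerXn2r ?nnegrE.
split; first by apply: (eq_intg _ sZ.2) => x; rewrite Z2.
under eq_Rintegral do rewrite Z2.
have ITZ : intg mu (fun x => TE x * Z x) := intgM TE_sq sZ.
have IBZ B : (0 < #|B| <= k)%N -> intg mu (fun x => tA B x * Z x).
  by move=> Bk; apply: intgMb Zm => //; exact: tA_intg.
have eTZ : \int[mu]_x (TE x * Z x) = \int[mu]_x (Z x ^+ 2).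
  under eq_Rintegral do rewrite TE_sum mulr_suml.
  under [RHS]eq_Rintegral do rewrite -YZ /TY mulr_suml.
  rewrite Rint_sum; last by move=> B; exact: IBZ.
  rewrite Rint_sum; last by move=> B /andP[Bk _]; exact: IBZ.
  rewrite (bigID (fun B : {set 'I_n} => B \subset A))/=.
  rewrite [X in _ + X]big1 ?addr0// => B /andP[Bk /exists_diff[i iB iA]].
  apply: (tA_orth Bk iB); last exact: IBZ.
  apply: depends_onS dZ; apply/fintype.subsetP => j jA; rewrite !inE.
  by apply: contraNneq iA => <-.
(* Since the mixed moment equals the second moment of [Z], this inequality bounds the latter by the
   second moment of [TE], whatever the truncation level. *)
have : 2 * \int[mu]_x (TE x * Z x) <= \int[mu]_x (TE x ^+ 2 + Z x ^+ 2).
  rewrite -RintZ//; apply: Rint_le; first exact: intgZ.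
    by apply: intgD; [exact: TE_sq.2|exact: sZ.2].
  by move=> x; have := sqr_ge0 (TE x - Z x); nra.
rewrite eTZ RintD; [|exact: TE_sq.2|exact: sZ.2].
lra.
Qed.

(** [TY A] consists of [tA A] and of components indexed by proper subsets of [A]; strong induction
    on the cardinal removes the latter. *)
Lemma tA_sqint A : (0 < #|A| <= k)%N -> sqint mu (tA A).
Proof.
have [m] := ubnP #|A|; elim: m A => // m IH A Am Ak.
have -> : tA A = fun x => TY A x -
    \sum_(B : {set 'I_n} | ((0 < #|B| <= k)%N && (B \subset A)) && (B != A)) tA B x.
  apply/funext => x; rewrite /TY (bigD1 A)/=; first by rewrite addrK.
  by rewrite Ak fintype.subxx.
apply: sqintB; first exact: TY_sqint.
apply: sqint_sum => B /andP[/andP[Bk BA] BneA]; apply: IH => //.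
apply: leq_trans (_ : #|A| <= m)%N; last by rewrite -ltnS.
by apply: proper_card; rewrite finset.properEneq BneA.
Qed.

Lemma tA_orthogonal A B : (0 < #|A| <= k)%N -> (0 < #|B| <= k)%N -> A != B ->
  \int[mu]_x (tA A x * tA B x) = 0.
Proof.
move=> Ak Bk AB.
(* Of two distinct sets one is not contained in the other, and an index lying only in that one is
   integrated out. *)
wlog BA : A B Ak Bk AB / ~~ (A \subset B).
  move=> H; have [sAB|] := boolP (A \subset B); last exact: H.
  under eq_Rintegral do rewrite mulrC; apply: H => //; first by rewrite eq_sym.
  by apply: contraNN AB => sBA; rewrite finset.eqEsubset sAB.
have [i iA iB] := exists_diff BA.
apply: (tA_orth Ak iA); last by apply: intgM; exact: tA_sqint.
apply: depends_onS (@depends_on_tA _ _ t B); apply/fintype.subsetP => j jB.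
by rewrite !inE; apply: contraNneq iB => <-.
Qed.

Lemma Rint_TE2 : \int[mu]_x (TE x ^+ 2) =
  \sum_(A : {set 'I_n} | (0 < #|A| <= k)%N) \int[mu]_x (tA A x ^+ 2).
Proof.
have I2 A B : (0 < #|A| <= k)%N -> (0 < #|B| <= k)%N -> intg mu (fun x => tA A x * tA B x).
  by move=> Ak Bk; apply: intgM; exact: tA_sqint.
under eq_Rintegral do rewrite expr2 !TE_sum mulr_suml.
rewrite Rint_sum; last first.
  move=> A Ak.
  have : intg mu (fun x : E => \sum_(B : {set 'I_n} | (0 < #|B| <= k)%N) tA A x * tA B x).
    by apply: intg_sum => B; exact: I2.
  by apply: eq_intg => x; rewrite mulr_sumr.
apply: eq_bigr => A Ak; under eq_Rintegral do rewrite mulr_sumr.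
rewrite Rint_sum; last by move=> B; exact: I2.
rewrite (bigD1 A)//= [X in _ + X]big1 ?addr0// => B /andP[Bk BA].
by apply: tA_orthogonal => //; rewrite eq_sym.
Qed.

End square_integrable.

End degenerate_statistic.

(** * The linear part *)

Section coordinates.
Context {R : realType} {n : nat}.
Local Notation E := (space R n).
Variables (mu : probability E R) (nu : probability R R).
Hypothesis iid : iid_law mu nu.
Implicit Types A B : {set 'I_n}.

Lemma coord_law i (B : set R) : measurable B -> mu ((fun x : E => x i) @^-1` B) = nu B.
Proof.
move=> mB; rewrite (_ : _ @^-1` _ = rect (fun j => if j == i then B else setT)).
  rewrite iid; last by move=> j; case: ifP.
  rewrite (bigD1 i)//= eqxx big1 ?mule1// => j /negPf ->.
  exact: probability_setT.
apply/seteqP; split => [x /= Bx j|x /= /(_ i)]; last by rewrite eqxx.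
by case: eqP => [->|].
Qed.

Lemma coord_intg (phi : R -> R) i : intg nu phi -> intg mu (fun x : E => phi (x i)).
Proof.
move=> I; apply/(intg_transport (measurable_coord i) (@coord_law i)) => //.
exact: intg_measurable I.
Qed.

Lemma coord_Rint (phi : R -> R) i : intg nu phi ->
  \int[mu]_x phi (x i) = \int[nu]_y phi y.
Proof. exact: (Rint_transport (measurable_coord i) (@coord_law i)). Qed.

Lemma indep_prod (phi : 'I_n -> R -> R) (s : seq 'I_n) : uniq s ->
  (forall i, intg nu (phi i)) ->
  intg mu (fun x : E => \prod_(i <- s) phi i (x i)) /\
  \int[mu]_x (\prod_(i <- s) phi i (x i)) = \prod_(i <- s) \int[nu]_y phi i y.
Proof.
move=> us I; elim: s us => [_|i s IH /= /andP[si us]].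
  split.
    by apply: (eq_intg _ (intg_cst mu 1)) => x; rewrite big_nil.
  by under eq_Rintegral do rewrite big_nil; rewrite big_nil Rint_cst.
have [I1 e1] := IH us.
have [|||||I2 e2] := @indep_intg _ _ _ _ iid [set i]%SET [set j in s]%SET
   (fun x : E => phi i (x i)) (fun x : E => \prod_(i <- s) phi i (x i)).
- by move=> j; rewrite !inE => /eqP ->.
- by move=> x y xy; rewrite xy// inE.
- move=> x y xy; rewrite !big_seq; apply: eq_bigr => j js.
  by rewrite xy// inE.
- exact: coord_intg.
- exact: I1.
split; first by apply: (eq_intg _ I2) => x; rewrite big_cons.
under eq_Rintegral do rewrite big_cons.
by rewrite e2 coord_Rint// big_cons e1.
Qed.

Lemma indep_prod_set (phi : 'I_n -> R -> R) A : (forall i, intg nu (phi i)) ->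
  intg mu (fun x : E => \prod_(i in A) phi i (x i)) /\
  \int[mu]_x (\prod_(i in A) phi i (x i)) = \prod_(i in A) \int[nu]_y phi i y.
Proof.
move=> I; have [I1 e1] := indep_prod (enum_uniq A) I.
split; first by apply: (eq_intg _ I1) => x; rewrite big_enum.
by rewrite -[RHS]big_enum -e1; apply: eq_Rintegral => x _; rewrite big_enum.
Qed.

End coordinates.

Section linear_part.
Context {R : realType} {n : nat}.
Local Notation E := (space R n).
Variables (mu : probability E R) (nu : probability R R).
Hypothesis iid : iid_law mu nu.
Implicit Types A B : {set 'I_n}.
Variables (l : R -> R) (beta : R).
Hypothesis n_gt0 : (0 < n)%N.
Hypothesis ml : measurable_fun [set: R] l.
Hypothesis l_mean : \int[nu]_y l y = 0.
Hypothesis l_var : \int[nu]_y (l y ^+ 2) = n%:R^-1.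
Hypothesis l_intg3 : intg nu (fun y => `|l y| ^+ 3).
Hypothesis l_third : n%:R * \int[nu]_y (`|l y| ^+ 3) = beta.

Lemma l_intg2 : intg nu (fun y => l y ^+ 2).
Proof.
apply: (intg_le _ _ (intgD (intg_cst nu 1) l_intg3)); first exact: measurable_funX.
move=> y; rewrite ger0_norm ?sqr_ge0// -[l y ^+ 2]real_normK ?num_real//.
by have := normr_ge0 (l y); move: `|l y| => a a0;
  have := mulr_ge0 a0 (sqr_ge0 (a - 1)); have := sqr_ge0 (2 * a - 1); lra.
Qed.

Lemma l_sqint : sqint nu l.
Proof. by split => //; exact: l_intg2. Qed.

Lemma l_intg : intg nu l.
Proof. exact: sqint_intg l_sqint. Qed.

Lemma nR_gt0 : 0 < n%:R :> R.
Proof. by rewrite ltr0n. Qed.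

Lemma coord_l_sqint i : sqint mu (fun x : E => l (x i)).
Proof.
split; first by apply: measurableT_comp => //; exact: measurable_coord.
exact: (coord_intg iid i l_intg2).
Qed.

Definition LE (x : E) : R := \sum_(i < n) l (x i).

Definition Lsum A (x : E) : R := \sum_(i in A) l (x i).

Definition Lprod A (x : E) : R := \prod_(i in A) l (x i).

Lemma Lsum_sqint A : sqint mu (Lsum A).
Proof. by apply: sqint_sum => i _; exact: coord_l_sqint. Qed.

Lemma LE_sqint : sqint mu LE.
Proof. by apply: sqint_sum => i _; exact: coord_l_sqint. Qed.

Lemma Rint_Lprod2 A : intg mu (fun x => Lprod A x ^+ 2) /\
  \int[mu]_x (Lprod A x ^+ 2) = n%:R^-1 ^+ #|A|.
Proof.
have [I e] := indep_prod_set iid A (fun=> l_intg2).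
split; first by apply: (eq_intg _ I) => x; rewrite /Lprod prodrXl.
under eq_Rintegral do rewrite /Lprod -prodrXl.
by rewrite e l_var prodr_const.
Qed.

Lemma Lprod_sqint A : sqint mu (Lprod A).
Proof.
split; last exact: (Rint_Lprod2 A).1.
exact: intg_measurable (indep_prod_set iid A (fun=> l_intg)).1.
Qed.

Lemma depends_on_Lprod A : depends_on A (Lprod A).
Proof. by move=> x y xy; apply: eq_bigr => i iA; rewrite xy. Qed.

Lemma depends_on_Lsum A : depends_on A (Lsum A).
Proof. by move=> x y xy; apply: eq_bigr => i iA; rewrite xy. Qed.

(** By independence the factor at [i] contributes the third absolute moment [beta / n], every other
    factor the variance [1 / n]. *)
Lemma Rint_Lprod2_abs A i : i \in A ->
  intg mu (fun x => Lprod A x ^+ 2 * `|l (x i)|) /\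
  \int[mu]_x (Lprod A x ^+ 2 * `|l (x i)|) = beta * n%:R^-1 ^+ #|A|.
Proof.
move=> iA; pose phi j y := l y ^+ 2 * (if j == i then `|l y| else 1).
have Iphi j : intg nu (phi j).
  rewrite /phi; case: (j == i).
    apply: (eq_intg _ l_intg3) => y.
    by rewrite -[l y ^+ 2]real_normK ?num_real// exprSr.
  by apply: (eq_intg _ l_intg2) => y; rewrite mulr1.
have [I e] := indep_prod_set iid A Iphi.
have E1 (x : E) : \prod_(j in A) phi j (x j) = Lprod A x ^+ 2 * `|l (x i)|.
  rewrite /phi big_split/= /Lprod -prodrXl; congr (_ * _).
  by rewrite (bigD1 i)//= eqxx big1 ?mulr1// => j /andP[_ /negPf ->].
split; first exact: (eq_intg E1 I).
transitivity (\int[mu]_x \prod_(j in A) phi j (x j)).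
  by apply: eq_Rintegral => x _; rewrite E1.
rewrite e (bigD1 i)//=.
rewrite (eq_bigr (fun=> n%:R^-1)); last first.
  move=> j /andP[_ /negPf ji]; rewrite -l_var; apply: eq_Rintegral => y _.
  by rewrite /phi ji mulr1.
have -> : \int[nu]_y phi i y = beta / n%:R.
  rewrite -l_third mulrAC mulfV ?mul1r; last by rewrite gt_eqF// nR_gt0.
  apply: eq_Rintegral => y _; rewrite /phi eqxx.
  by rewrite -[l y ^+ 2]real_normK ?num_real// -exprSr.
rewrite prodr_const -mulrA -exprS; congr (_ * _ ^+ _).
rewrite [RHS](cardD1 i) iA add1n; congr _.+1.
by apply: eq_card => j; rewrite !inE andbC.
Qed.

(** A case of Lyapunov's inequality. It absorbs into [beta] the errors of order [n^(-1/2)]: first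
    absolute moments of finitely many summands and the third moments of the Gaussian
    replacements. *)
Lemma beta_ge : (Num.sqrt n%:R)^-1 <= beta.
Proof.
pose a : R := (Num.sqrt n%:R)^-1.
have a0 : 0 < a by rewrite invr_gt0 sqrtr_gt0 nR_gt0.
have a2 : a ^+ 2 = n%:R^-1 by rewrite exprVn sqr_sqrtr// ler0n.
have h : \int[nu]_y (3 * a * l y ^+ 2) <= \int[nu]_y (2 * `|l y| ^+ 3 + a ^+ 3).
  apply: Rint_le.
  - exact: intgZ l_intg2.
  - by apply: intgD; [exact: intgZ l_intg3|exact: intg_cst].
  move=> y; rewrite -[l y ^+ 2]real_normK ?num_real//.
  have := normr_ge0 (l y); move: `|l y| => b b0.
  (* AM-GM in the factored form [2b^3 + a^3 - 3ab^2 = (b - a)^2 (2b + a)] *)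
  have : 0 <= (b - a) ^+ 2 * (2 * b + a) by rewrite mulr_ge0 ?sqr_ge0//; lra.
  by move=> ?; lra.
move: h; rewrite RintZ; last exact: l_intg2.
rewrite RintD; [|exact: intgZ l_intg3|exact: intg_cst].
rewrite RintZ// Rint_cst l_var -a2 => h.
rewrite -/a -l_third.
have -> : n%:R = (a ^+ 2)^-1 by rewrite a2 invrK.
rewrite mulrC ler_pdivlMr ?exprn_gt0//.
move: h; move: (\int[nu]_y (`|l y| ^+ 3)) => b.
by move=> h; nra.
Qed.

Lemma beta_gt0 : 0 < beta.
Proof. by apply: lt_le_trans beta_ge; rewrite invr_gt0 sqrtr_gt0 nR_gt0. Qed.

Lemma Rint_abs_l : \int[nu]_y `|l y| <= (Num.sqrt n%:R)^-1.
Proof.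
pose a : R := (Num.sqrt n%:R)^-1.
have a0 : 0 < a by rewrite invr_gt0 sqrtr_gt0 nR_gt0.
have a2 : a ^+ 2 = n%:R^-1 by rewrite exprVn sqr_sqrtr// ler0n.
have h : \int[nu]_y (2 * a * `|l y|) <= \int[nu]_y (l y ^+ 2 + a ^+ 2).
  apply: Rint_le.
  - exact: intgZ (intg_norm l_intg).
  - by apply: intgD; [exact: l_intg2|exact: intg_cst].
  move=> y; rewrite -[l y ^+ 2]real_normK ?num_real//.
  by have := sqr_ge0 (`|l y| - a); lra.
move: h; rewrite RintZ; last exact: intg_norm l_intg.
rewrite RintD; [|exact: l_intg2|exact: intg_cst].
rewrite Rint_cst l_var -a2 -/a => h.
rewrite -(ler_pM2l a0); lra.
Qed.

Lemma Rint_abs_Lsum A : \int[mu]_x `|Lsum A x| <= #|A|%:R * beta.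
Proof.
have I i : intg mu (fun x : E => `|l (x i)|).
  by apply: intg_norm; apply: sqint_intg; exact: coord_l_sqint.
apply: (@le_trans _ _ (\int[mu]_x \sum_(i in A) `|l (x i)|)).
  apply: Rint_le.
  - by apply: intg_norm; apply: sqint_intg; exact: Lsum_sqint.
  - by apply: intg_sum.
  - by move=> x; exact: ler_norm_sum.
rewrite Rint_sum// mulr_natl -sumr_const; apply: ler_sum => i _.
rewrite (coord_Rint iid i (intg_norm l_intg)).
exact: le_trans Rint_abs_l beta_ge.
Qed.

End linear_part.

(** * Taylor expansions and mixed differences *)

Section calculus.
Context {R : realType}.
Implicit Types (g f : R -> R) (x y h K M : R).

Definition has_deriv f f' := forall x, is_derive x (1 : R) f (f' x).

Lemma has_deriv_cont f f' : has_deriv f f' -> continuous f.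
Proof.
move=> df x; apply/differentiable_continuous/derivable1_diffP.
by case: (df x).
Qed.

Lemma mvt f f' x h : has_deriv f f' ->
  exists xi, `|xi - x| <= `|h| /\ f (x + h) - f x = h * f' xi.
Proof.
move=> df; have cf := has_deriv_cont df.
have [h0|h0|->] := ltgtP h 0.
- have /(@MVT R f f') [] : x + h < x by rewrite gtrDl.
  + by move=> z _; exact: df.
  + exact: continuous_subspaceT.
  move=> xi; rewrite in_itv /= => /andP[x1 x2] e; exists xi; split.
    by rewrite ltr0_norm ?subr_lt0// ltr0_norm// opprB; lra.
  move: e; rewrite opprD addrA subrr sub0r mulrN => e.
  by apply: oppr_inj; rewrite opprB e mulrC.
- have /(@MVT R f f') [] : x < x + h by rewrite ltrDl.
  + by move=> z _; exact: df.
  + exact: continuous_subspaceT.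
  move=> xi; rewrite in_itv /= => /andP[x1 x2] e; exists xi; split.
    by rewrite gtr0_norm ?subr_gt0// gtr0_norm//; lra.
  by rewrite e addrAC subrr add0r mulrC.
- by exists x; rewrite subrr normr0 lexx addr0 subrr mul0r.
Qed.

Lemma lip_of_deriv f f' K : has_deriv f f' -> (forall x, `|f' x| <= K) ->
  forall x y, `|f x - f y| <= K * `|x - y|.
Proof.
move=> df bf x y; have [xi [_]] := mvt y (x - y) df.
rewrite (_ : y + (x - y) = x); last by rewrite addrC subrK.
by move=> ->; rewrite normrM mulrC ler_wpM2r.
Qed.

(** Two applications of the mean value theorem lose only the factor 1/2 of the sharp remainder. The
    bound on [f2] is local because the exponential is one of the functions to be expanded. *)
Lemma taylor2 f f1 f2 x h K : has_deriv f f1 -> has_deriv f1 f2 ->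
  (forall s, `|s - x| <= `|h| -> `|f2 s| <= K) ->
  `|f (x + h) - f x - h * f1 x| <= K * h ^+ 2.
Proof.
move=> d1 d2 b2; have [xi [hxi ->]] := mvt x h d1.
have [xi2 [hxi2 e]] := mvt x (xi - x) d2.
rewrite -mulrBr normrM.
have -> : f1 xi - f1 x = (xi - x) * f2 xi2.
  by rewrite -e; congr (f1 _ - _); rewrite addrC subrK.
rewrite normrM -[h ^+ 2]real_normK ?num_real// expr2 mulrCA mulrA.
rewrite [leRHS]mulrC; apply: ler_pM => //.
- by rewrite ler_wpM2r.
- by apply: b2; exact: le_trans hxi.
Qed.

Lemma is_derive_shift f f' x a : has_deriv f f' ->
  is_derive a (1 : R) (fun s => f (x + s)) (f' (x + a)).
Proof.
move=> df; have h := df (x + a).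
have := is_deriveD (is_derive_cst x a (1 : R)) (is_derive_id a (1 : R)).
rewrite add0r => hs.
have := @is_derive1_comp _ f _ a _ _ h hs.
by rewrite mulr1.
Qed.

Lemma taylor3 f f1 f2 f3 x h K : has_deriv f f1 -> has_deriv f1 f2 -> has_deriv f2 f3 ->
  (forall s, `|s - x| <= `|h| -> `|f3 s| <= K) ->
  `|f (x + h) - f x - h * f1 x - h ^+ 2 / 2 * f2 x| <= K * `|h| ^+ 3.
Proof.
move=> d1 d2 d3 b3.
(* The remainder as a function of the increment: its derivative [r'] is the first-order remainder of
   [f1], which [taylor2] controls. *)
pose r s := f (x + s) - f x - s * f1 x - s ^+ 2 / 2 * f2 x.
pose r' s := f1 (x + s) - f1 x - s * f2 x.
have dr : has_deriv r r'.
  move=> a.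
  have h1 := is_derive_shift x a d1.
  have h2 : is_derive a (1 : R) (fun s => s * f1 x) (f1 x).
    by apply: is_derive_eq; rewrite scaler0 add0r /GRing.scale /= mulr1.
  have h3 : is_derive a (1 : R) (fun s => s ^+ 2 / 2 * f2 x) (a * f2 x).
    by apply: is_derive_eq; rewrite /GRing.scale /=; field.
  have := is_deriveB (is_deriveB (is_deriveB h1 (is_derive_cst (f x) a 1)) h2) h3.
  by rewrite subr0.
have [xi [hxi e]] := mvt 0 h dr.
have -> : f (x + h) - f x - h * f1 x - h ^+ 2 / 2 * f2 x = r (0 + h) - r 0.
  by rewrite /r add0r addr0 subrr !mul0r expr0n /= !mul0r !subr0.
rewrite e normrM (exprS _ 2) [leRHS]mulrCA ler_wpM2l//.
move: hxi; rewrite subr0 => hxi.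
have := taylor2 d2 d3 (x := x) (h := xi) (K := K) _.
rewrite -/(r' xi) => h2; apply: (le_trans (h2 _)).
  by move=> s hs; apply: b3; exact: le_trans hxi.
rewrite -[xi ^+ 2]real_normK ?num_real//; apply: ler_wpM2l.
  by apply: le_trans (b3 x _) => //; rewrite subrr normr0.
by rewrite lerXn2r ?nnegrE.
Qed.

Fixpoint mdiff (g : R -> R) (ys : seq R) (x : R) : R :=
  if ys is y :: ys' then mdiff g ys' (x + y) - mdiff g ys' x else g x.

Lemma mdiff_deriv g g' ys : has_deriv g g' -> has_deriv (mdiff g ys) (mdiff g' ys).
Proof.
move=> dg; elim: ys => //= y ys IH x; apply: is_deriveB; last exact: IH.
have := is_derive_shift y x IH.
by rewrite addrC; congr is_derive; apply/funext => s /=; rewrite addrC.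
Qed.

(** Differencing commutes with differentiation, so each use of the mean value theorem strips one
    difference and shifts the family [G] by one. Nothing makes [xi] measurable in the data; it may
    enter pointwise estimates only. *)
Lemma mdiff_mvt (G : nat -> R -> R) m ys x :
  (forall j, (j < m)%N -> has_deriv (G j) (G j.+1)) -> (size ys <= m)%N ->
  exists xi, `|xi - x| <= \sum_(y <- ys) `|y| /\
    mdiff (G 0%N) ys x = (\prod_(y <- ys) y) * G (size ys) xi.
Proof.
elim: ys m G x => [|y ys IH] m G x dG /= sm.
  by exists x; rewrite !big_nil subrr normr0 mul1r.
have m0 : (0 < m)%N by exact: leq_ltn_trans sm.
have [x1 [h1 ->]] := mvt x y (mdiff_deriv ys (dG 0%N m0)).
have [||xi [h2 ->]] := IH m.-1 (fun j => G j.+1) x1.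
- by move=> j jm; apply: dG; rewrite -(prednK m0) ltnS.
- by rewrite -ltnS prednK.
exists xi; split; last by rewrite big_cons mulrA.
rewrite big_cons; apply: le_trans (lerD h1 h2).
rewrite (_ : xi - x = (x1 - x) + (xi - x1)); first exact: ler_normD.
by ring.
Qed.

End calculus.

(** * Stability and moments of the normal law *)

Section gaussian.
Context {R : realType}.
Local Notation leb := (@lebesgue_measure R).
Implicit Types (m s a b c x y : R).

(** The Radon-Nikodym derivative of the normal law and [normal_pdf] have the same integral over
    every measurable set, hence agree almost everywhere. *)
Lemma ge0_integral_normal m s (f : R -> \bar R) : measurable_fun [set: R] f ->
  (forall x, 0 <= f x)%E ->
  (\int[normal_prob m s]_x f x = \int[leb]_x (f x * (normal_pdf m s x)%:E))%E.
Proof.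
move=> mf f0; have dom := @normal_prob_dominates R m s.
pose h := Radon_Nikodym_SigmaFinite.f (normal_prob m s) leb.
have Ih : leb.-integrable setT h := Radon_Nikodym_SigmaFinite.f_integrable dom.
have mh : measurable_fun [set: R] h := measurable_int _ Ih.
have mp : measurable_fun [set: R] (fun x => (normal_pdf m s x)%:E).
  by apply/measurable_EFinP; exact: measurable_normal_pdf.
rewrite -(Radon_Nikodym_SigmaFinite.change_of_variables dom f0 measurableT mf).
apply: ge0_ae_eq_integral => //.
- exact: emeasurable_funM.
- exact: emeasurable_funM.
- by move=> x _; rewrite mule_ge0//; exact: Radon_Nikodym_SigmaFinite.f_ge0.
- by move=> x _; rewrite mule_ge0// lee_fin normal_pdf_ge0.
apply: ae_eqe_mul2l; apply: integral_ae_eq => //.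
move=> A _ mA; rewrite /h -Radon_Nikodym_SigmaFinite.f_integral//.
Qed.

Lemma normal_peak_scale s : 0 < s -> normal_peak s = s^-1 * normal_peak 1.
Proof.
move=> s0; rewrite /normal_peak expr1n mul1r -mulrnAr sqrtrM ?sqr_ge0//.
by rewrite sqrtr_sqr gtr0_norm// invfM.
Qed.

Lemma normal_pdf_affine m s x : 0 < s ->
  normal_pdf m s (m + s * x) * s = normal_pdf 0 1 x.
Proof.
move=> s0; rewrite !normal_pdfE ?gt_eqF// /normal_fun.
have -> : - (m + s * x - m) ^+ 2 / (s ^+ 2 *+ 2) = - (x - 0) ^+ 2 / (1 ^+ 2 *+ 2).
  by field; rewrite gt_eqF.
rewrite mulrAC; congr (_ * _).
by rewrite normal_peak_scale// mulrAC mulVf ?mul1r// gt_eqF.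
Qed.

Lemma ge0_integral_affine m s (u : R -> R) : 0 < s -> continuous u ->
  (forall x, 0 <= u x) ->
  (\int[normal_prob 0 1]_x (u (m + s * x))%:E =
   \int[leb]_x (u x * normal_pdf m s x)%:E)%E.
Proof.
move=> s0 cu u0; pose F x := m + s * x.
have dF : has_deriv F (fun=> s).
  move=> x.
  have := is_deriveD (is_derive_cst m x (1 : R)) (is_deriveZ s (is_derive_id x (1 : R))).
  by rewrite add0r /GRing.scale /= mulr1.
have cF := has_deriv_cont dF.
have F'E : F^`()%classic = cst s.
  apply/funext => x; rewrite derive1E; exact: derive_val.
rewrite ge0_integral_normal; last 2 first.
- apply/measurable_EFinP; apply: continuous_measurable_fun => x.
  by apply: continuous_comp; [exact: cF|exact: cu].
- by move=> x; rewrite lee_fin.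
rewrite (@increasing_ge0_integration_by_substitutionT _ F
  (fun x => u x * normal_pdf m s x)).
- apply: eq_integral => x _; rewrite /= F'E /= -EFinM; congr EFin.
  by rewrite -(@normal_pdf_affine m s)// mulrA.
- by move=> x y xy; rewrite /F ltrD2l ltr_pM2l.
- by rewrite F'E => ?; exact: cvg_cst.
- by rewrite F'E; exact: is_cvg_cst.
- by rewrite F'E; exact: is_cvg_cst.
- by move=> x; case: (dF x).
- rewrite /F (_ : (fun x => m + s * x) = (fun x => x + m) \o (fun x => s * x)).
    apply: (cvg_comp _ _ (gt0_cvgMrNy _ _)) => //.
    exact: cvg_addrr_Ny.
  by apply/funext => x /=; rewrite addrC.
- rewrite /F (_ : (fun x => m + s * x) = (fun x => x + m) \o (fun x => s * x)).
    apply: (cvg_comp _ _ (gt0_cvgMry _ _)) => //.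
    exact: cvg_addrr.
  by apply/funext => x /=; rewrite addrC.
- move=> x; apply: cvgM; first exact: cu.
  by apply: continuous_normal_pdf; rewrite gt_eqF.
- by move=> x; rewrite mulr_ge0// normal_pdf_ge0.
Qed.

(* Completing the square. *)
Lemma normal_pdf_conv a b c v y : 0 < a -> 0 < c -> c ^+ 2 = a ^+ 2 + b ^+ 2 ->
  normal_pdf (b * y) a v * normal_pdf 0 1 y =
  normal_pdf 0 c v * normal_pdf (b * v / c ^+ 2) (a / c) y.
Proof.
move=> a0 c0 cab.
have ac0 : 0 < a / c by rewrite divr_gt0.
rewrite !normal_pdfE ?gt_eqF// /normal_fun.
rewrite mulrACA [RHS]mulrACA -!expRD; congr (_ * expR _).
  rewrite (normal_peak_scale a0) (normal_peak_scale c0) (normal_peak_scale ac0).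
  by field; rewrite !gt_eqF.
have c20 : c ^+ 2 != 0 by rewrite gt_eqF// exprn_gt0.
have bE : b ^+ 2 = c ^+ 2 - a ^+ 2 by rewrite cab addrC addKr.
rewrite ?expr1n.
have -> : - (y - b * v / c ^+ 2) ^+ 2 / ((a / c) ^+ 2 *+ 2) =
  - (c ^+ 2 * y ^+ 2 - 2 * b * v * y + (c ^+ 2 - a ^+ 2) * v ^+ 2 / c ^+ 2) / (a ^+ 2 *+ 2).
  by rewrite -bE; field; rewrite !gt_eqF.
have -> : - (v - b * y) ^+ 2 / (a ^+ 2 *+ 2) =
  - (v ^+ 2 - 2 * b * v * y + (c ^+ 2 - a ^+ 2) * y ^+ 2) / (a ^+ 2 *+ 2).
  by rewrite -bE; field; rewrite !gt_eqF.
by field; rewrite !gt_eqF.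
Qed.

Lemma measurable_pdf_joint a b : a != 0 ->
  measurable_fun [set: R * R] (fun z : R * R => normal_pdf (b * z.1) a z.2).
Proof.
move=> a0.
have -> : (fun z : R * R => normal_pdf (b * z.1) a z.2) =
    fun z => normal_peak a * normal_fun (b * z.1) a z.2.
  by apply/funext => z; rewrite normal_pdfE.

apply: measurable_funM => //; apply: measurableT_comp => //.
apply: measurable_funM => //; apply: measurableT_comp => //.
apply: measurable_funX; apply: measurable_funB; first exact: measurable_snd.
by apply: measurable_funM => //; exact: measurable_fst.
Qed.

(** After Tonelli, completing the square splits the joint density into the density of the sum and a
    normal density in the other variable, whose integral is 1. *)
Lemma ge0_gauss_stable a b c (u : R -> R) : 0 < a -> 0 < b -> 0 < c ->
  c ^+ 2 = a ^+ 2 + b ^+ 2 -> continuous u -> (forall x, 0 <= u x) ->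
  (\int[(normal_prob 0 1 \x normal_prob 0 1)]_z (u (b * z.1 + a * z.2))%:E =
   \int[normal_prob 0 1]_x (u (c * x))%:E)%E.
Proof.
move=> a0 b0 c0 cab cu u0.
have mu : measurable_fun [set: R] u by exact: continuous_measurable_fun.
have mp a' b' : a' != 0 -> measurable_fun [set: R * R]
    (fun z : R * R => (u z.2 * normal_pdf (b' * z.1) a' z.2)%:E).
  move=> a'0; apply/measurable_EFinP; apply: measurable_funM.
    by apply: measurableT_comp => //; exact: measurable_snd.
  exact: measurable_pdf_joint.
rewrite fubini_tonelli1//=; last 2 first.
- apply/measurable_EFinP; apply: measurableT_comp => //.
  by apply: measurable_funD; apply: measurable_funM.
- by move=> x; rewrite lee_fin.
rewrite /fubini_F.
under eq_integral => y _ do rewrite /= (ge0_integral_affine (b * y) a0 cu u0).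
rewrite ge0_integral_normal; last 2 first.
- apply: (@measurable_fun_fubini_tonelli_F _ _ _ _ R leb _ (mp _ b (lt0r_neq0 a0))).
  by move=> z; rewrite lee_fin mulr_ge0 ?normal_pdf_ge0.
- by move=> y; apply: integral_ge0 => v _; rewrite lee_fin mulr_ge0 ?normal_pdf_ge0.
under eq_integral => y _.
  rewrite -ge0_integralZr//; last 3 first.
  - apply/measurable_EFinP; apply: measurable_funM => //.
    exact: measurable_normal_pdf.
  - by move=> v _; rewrite lee_fin mulr_ge0 ?normal_pdf_ge0.
  - by rewrite lee_fin normal_pdf_ge0.
  over.
rewrite /=.
rewrite (@fubini_tonelli _ _ _ _ R leb leb (fun z : R * R =>
   (u z.2 * normal_pdf (b * z.1) a z.2)%:E * (normal_pdf 0 1 z.1)%:E)%E)/=; last 2 first.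
- apply: emeasurable_funM; first exact: mp (lt0r_neq0 a0).
  apply/measurable_EFinP; apply: measurableT_comp => //.
  exact: measurable_normal_pdf.
- by move=> z; rewrite mule_ge0// lee_fin ?mulr_ge0// normal_pdf_ge0.
transitivity (\int[leb]_v (u v * normal_pdf 0 c v)%:E)%E.
  apply: eq_integral => v _.
  under eq_integral => y _.
    rewrite -EFinM -mulrA (normal_pdf_conv v y a0 c0 cab) mulrA EFinM.
    over.
  rewrite ge0_integralZl//; last 3 first.
  - by apply/measurable_EFinP; exact: measurable_normal_pdf.
  - by move=> y _; rewrite lee_fin normal_pdf_ge0.
  - by rewrite lee_fin mulr_ge0// normal_pdf_ge0.
  by rewrite integral_normal_pdf mule1.
have := ge0_integral_affine 0 c0 cu u0; rewrite -/normal_pdf => <-.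
by apply: eq_integral => x _; rewrite add0r.
Qed.

Lemma gauss_stable a b c (u : R -> R) : 0 < a -> 0 < b -> 0 < c ->
  c ^+ 2 = a ^+ 2 + b ^+ 2 -> continuous u ->
  intg (normal_prob (0 : R) 1) (fun x => u (c * x)) ->
  intg (normal_prob (0 : R) 1 \x normal_prob (0 : R) 1)%E (fun z => u (b * z.1 + a * z.2)) /\
  \int[(normal_prob (0 : R) 1 \x normal_prob (0 : R) 1)%E]_z u (b * z.1 + a * z.2) =
  \int[normal_prob 0 1]_x u (c * x).
Proof.
move=> a0 b0 c0 cab cu Iu.
have ge0 (w : R -> R) : continuous w -> (forall x, 0 <= w x) ->
    intg (normal_prob (0 : R) 1) (fun x => w (c * x)) ->
    intg (normal_prob (0 : R) 1 \x normal_prob (0 : R) 1)%E (fun z => w (b * z.1 + a * z.2)) /\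
    \int[(normal_prob (0 : R) 1 \x normal_prob (0 : R) 1)%E]_z w (b * z.1 + a * z.2) =
    \int[normal_prob 0 1]_x w (c * x).
  move=> cw w0 /integrableP[_ Iw]; have e := ge0_gauss_stable a0 b0 c0 cab cw w0.
  split; last by rewrite /Rintegral e.
  apply/integrableP; split.
    apply/measurable_EFinP; apply: measurableT_comp; first exact: continuous_measurable_fun.
    by apply: measurable_funD; apply: measurable_funM.
  under eq_integral => z _ do rewrite /= ger0_norm//.
  by move: Iw; under eq_integral => z _ do rewrite /= ger0_norm//; rewrite e.
(* Tonelli covers nonnegative functions; positive and negative parts remain continuous and are
   dominated by [|u|]. *)
pose up x : R := Num.max (u x) 0; pose un x : R := Num.max (- u x) 0.
have cup : continuous up.
  by move=> x; apply: continuous_max; [exact: cu|exact: cvg_cst].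
have cun : continuous un.
  move=> x; apply: (@continuous_max _ _ (fun x => - u x)); last exact: cvg_cst.
  by apply: continuousN; exact: cu.
have uE x : u x = up x - un x.
  rewrite /up /un; have [h|h] := leP (u x) 0.
    by rewrite max_l ?oppr_ge0// sub0r opprK.
  by rewrite max_r ?oppr_le0 ?ltW// subr0.
have bd (w : R -> R) : continuous w -> (forall x, `|w x| <= `|u x|) ->
    intg (normal_prob (0 : R) 1) (fun x => w (c * x)).
  move=> cw wu; apply: (intg_le _ _ (intg_norm Iu)).
    apply: measurableT_comp; first exact: continuous_measurable_fun.
    exact: measurable_funM.
  by move=> x; exact: wu.
have up0 x : 0 <= up x by rewrite le_max lexx orbT.
have un0 x : 0 <= un x by rewrite le_max lexx orbT.
have upu x : `|up x| <= `|u x|.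
  by rewrite ger0_norm// /up ge_max ler_norm normr_ge0.
have unu x : `|un x| <= `|u x|.
  by rewrite ger0_norm// /un ge_max -normrN ler_norm normr_ge0.
have [I1 e1] := ge0 up cup up0 (bd _ cup upu).
have [I2 e2] := ge0 un cun un0 (bd _ cun unu).
split; first by apply: (eq_intg _ (intgB I1 I2)) => z; rewrite uE.
under eq_Rintegral do rewrite uE; rewrite RintB// e1 e2.
rewrite -RintB; [|exact: (bd _ cup upu)|exact: (bd _ cun unu)].
by apply: eq_Rintegral => x _; rewrite uE.
Qed.

(** Multiplying the standard density by [expR (s * x)] gives [expR (s ^+ 2 / 2)] times the normal
    density of mean [s]. *)
Lemma mgf_normal s : intg (normal_prob (0 : R) 1) (fun x => expR (s * x)) /\
  \int[normal_prob 0 1]_x expR (s * x) = expR (s ^+ 2 / 2).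
Proof.
have m1 : measurable_fun [set: R] (fun x => (expR (s * x))%:E).
  by apply/measurable_EFinP; apply: measurableT_comp => //; exact: measurable_funM.
have e : (\int[normal_prob (0 : R) 1]_x (expR (s * x))%:E = (expR (s ^+ 2 / 2))%:E)%E.
  rewrite ge0_integral_normal; last 2 first.
  - exact: m1.
  - by move=> x; rewrite lee_fin expR_ge0.
  transitivity (\int[leb]_x ((expR (s ^+ 2 / 2))%:E * (normal_pdf s 1 x)%:E))%E.
    apply: eq_integral => x _; rewrite -!EFinM; congr EFin.
    rewrite !normal_pdfE ?oner_eq0// /normal_fun mulrCA [RHS]mulrCA -!expRD.
    by congr (_ * expR _); field.
  rewrite ge0_integralZl//; last 2 first.
  - by apply/measurable_EFinP; exact: measurable_normal_pdf.
  - by move=> y _; rewrite lee_fin normal_pdf_ge0.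
  by rewrite integral_normal_pdf mule1.
split; last by rewrite /Rintegral e.
apply/integrableP; split => //.
by under eq_integral => x _ do rewrite /= ger0_norm ?expR_ge0//; rewrite e ltry.
Qed.

Lemma has_deriv_expR : has_deriv (@expR R) expR.
Proof. by move=> x; exact: is_derive_expR. Qed.

Lemma expR_normE x : expR `|x| <= expR x + expR (- x).
Proof.
have [x0|x0] := ler0P x; first by rewrite lerDr expR_ge0.
by rewrite lerDl expR_ge0.
Qed.

Lemma norm3_le_expR x : `|x| ^+ 3 <= 6 * expR `|x|.
Proof.
have := @expR_ge1Dxn R `|x| 2 (normr_ge0 x).
rewrite (_ : 3`!%:R = 6 :> R)//; move: (expR _) => E; lra.
Qed.

Lemma normal_intg_norm3 : intg (normal_prob (0 : R) 1) (fun x => `|x| ^+ 3).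
Proof.
apply: (@intg_le _ _ _ (normal_prob (0 : R) 1) _ (fun x => 6 * (expR (1 * x) + expR (-1 * x)))).
- by apply: measurable_funX; exact: normr_measurable.
- move=> x; rewrite ger0_norm ?exprn_ge0// (le_trans (norm3_le_expR x))//.
  by rewrite ler_pM2l// mul1r mulN1r expR_normE.
- by apply: intgZ; apply: intgD; exact: (mgf_normal _).1.
Qed.

Lemma normal_sqint : sqint (normal_prob (0 : R) 1) (fun x => x).
Proof.
split=> //; apply: (intg_le _ _ (intgD (intg_cst _ 1) normal_intg_norm3)).
  exact: measurable_funX.
move=> x; rewrite ger0_norm ?sqr_ge0// -[x ^+ 2]real_normK ?num_real//.
have a0 := normr_ge0 x; move: `|x| a0 => a a0.
have := mulr_ge0 a0 (sqr_ge0 (a - 1)); have := sqr_ge0 (2 * a - 1); lra.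
Qed.

Lemma le0_of_linear (a K : R) : (forall s, 0 < s -> s <= 1 -> a <= K * s) -> a <= 0.
Proof.
move=> h; rewrite leNgt; apply/negP => a0.
(* This [s] is at most 1/2 and makes [K * s] smaller than [a]. *)
pose s := a / (2 * (`|K| + a)).
have Ka : 0 < `|K| + a by rewrite ltr_wpDl.
have s0 : 0 < s by rewrite divr_gt0// mulr_gt0.
have := h s s0; rewrite /s ler_pdivrMr ?mulr_gt0// => /(_ _).
have -> : a <= 1 * (2 * (`|K| + a)) by have := normr_ge0 K; lra.
move=> /(_ isT); rewrite mulrA ler_pdivlMr ?mulr_gt0// => h1.
have := ler_norm K; have := normr_ge0 K; move: `|K| h1 Ka => N h1 Ka N0 KN.
nra.
Qed.

(* Expanding the moment generating function to third order in [s]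
   identifies the first two moments. *)
Lemma normal_moments : \int[normal_prob (0 : R) 1]_x x = 0 /\
  \int[normal_prob (0 : R) 1]_x (x ^+ 2) = 1.
Proof.
pose m := \int[normal_prob (0 : R) 1]_x x; pose v := \int[normal_prob (0 : R) 1]_x (x ^+ 2).
rewrite -/m -/v.
have I1 := sqint_intg normal_sqint; have I2 := normal_sqint.2.
pose D x s := expR (s * x) - 1 - s * x - s ^+ 2 / 2 * x ^+ 2.
have ID s : intg (normal_prob (0 : R) 1) (D ^~ s).
  apply: intgB; last exact: intgZ.
  apply: intgB; last exact: intgZ.
  by apply: intgB; [exact: (mgf_normal s).1|exact: intg_cst].
have eD s : \int[normal_prob 0 1]_x D x s = expR (s ^+ 2 / 2) - 1 - s * m - s ^+ 2 / 2 * v.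
  rewrite /D RintB ?RintB ?RintZ//; first by rewrite (mgf_normal s).2 Rint_cst.
  - exact: (mgf_normal s).1.
  - exact: intg_cst.
  - by apply: intgB; [exact: (mgf_normal s).1|exact: intg_cst].
  - exact: intgZ.
  - apply: intgB; last exact: intgZ.
    by apply: intgB; [exact: (mgf_normal s).1|exact: intg_cst].
  - exact: intgZ.
(* The 6 comes from [|x| ^+ 3 <= 6 * expR |x|]; the means of [expR (2 * x)] and [expR (- 2 * x)]
   contribute [expR 2] each. *)
pose K := 12 * expR 2 : R.
have bD s : `|s| <= 1 -> `|expR (s ^+ 2 / 2) - 1 - s * m - s ^+ 2 / 2 * v| <= K * `|s| ^+ 3.
  move=> s1; rewrite -eD.
  have -> : K * `|s| ^+ 3 =
      \int[normal_prob 0 1]_x ((6 * `|s| ^+ 3) * (expR (2 * x) + expR (- 2 * x))).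
    rewrite RintZ ?RintD; [|exact: (mgf_normal _).1..|].
      rewrite !(mgf_normal _).2 sqrrN (_ : 2 ^+ 2 / 2 = 2 :> R); last by field.
      by rewrite /K; ring.
    by apply: intgD; exact: (mgf_normal _).1.
  apply: Rint_abs_le.
  - exact: intg_measurable (ID s).
  - by apply: intgZ; apply: intgD; exact: (mgf_normal _).1.
  move=> x; rewrite /D.
  have := @taylor3 _ _ _ _ _ 0 (s * x) (expR `|x|) has_deriv_expR has_deriv_expR has_deriv_expR.
  rewrite add0r expR0 !mulr1 exprMn mulrAC => /(_ _) h.
  apply: le_trans (h _) _.
    move=> r; rewrite subr0 [`|expR _|]ger0_norm ?expR_ge0// ler_expR => hr.
    apply: (le_trans (ler_norm r)); apply: (le_trans hr).
    by rewrite normrM ler_piMl.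
  rewrite normrM exprMn mulrCA -mulrA [leRHS]mulrCA ler_wpM2l ?exprn_ge0//.
  apply: (@le_trans _ _ (expR `|x| * (6 * expR `|x|))).
    by rewrite ler_wpM2l ?expR_ge0// norm3_le_expR.
  rewrite mulrCA ler_pM2l// -expRD.
  apply: le_trans (_ : expR `|2 * x| <= _).
    by rewrite ler_expR normrM ger0_norm//; lra.
  by rewrite mulNr expR_normE.
pose K2 := K + expR 1.
have bE s : `|s| <= 1 -> `|s * m + s ^+ 2 / 2 * (v - 1)| <= K2 * `|s| ^+ 3.
  move=> s1; have := bD s s1.
  have s2 : s ^+ 2 <= 1 by rewrite -[s ^+ 2]real_normK ?num_real// expr_le1.
  have := @taylor2 _ _ _ _ 0 (s ^+ 2 / 2) (expR 1) has_deriv_expR has_deriv_expR.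
  rewrite add0r expR0 mulr1 => /(_ _) h.
  have {}h := h _.
  have h2 : `|expR (s ^+ 2 / 2) - 1 - s ^+ 2 / 2| <= expR 1 * `|s| ^+ 3.
    apply: (le_trans (h _)).
      move=> r; rewrite subr0 [`|expR _|]ger0_norm ?expR_ge0// ler_expR => hr.
      apply: (le_trans (ler_norm r)); apply: (le_trans hr).
      rewrite ger0_norm ?divr_ge0 ?sqr_ge0//; lra.
    rewrite ler_wpM2l ?expR_ge0//.
    have e2 : s ^+ 2 = `|s| ^+ 2 by rewrite real_normK ?num_real.
    rewrite e2; have := normr_ge0 s; move: `|s| s1 => a a1 a0.
    have h4 : a ^+ 4 <= a ^+ 3 by rewrite exprS ler_piMl ?exprn_ge0.
    have := exprn_ge0 4 a0; rewrite expr_div_n -exprM; lra.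
  rewrite /K2 mulrDl; move: h2; rewrite !ler_norml => /andP[? ?] /andP[? ?].
  by apply/andP; split; lra.
(* Adding the estimates at [s] and [- s] cancels the first moment; division by [s ^+ 2] leaves a
   bound linear in [s]. *)
have v1 : `|v - 1| <= 0.
  apply: (@le0_of_linear _ (2 * K2)) => s s0 s1.
  have := bE s; rewrite (gtr0_norm s0) => /(_ s1) h2.
  have := bE (- s); rewrite normrN (gtr0_norm s0) => /(_ s1).
  rewrite (_ : (- s) ^+ 2 = s ^+ 2) => [h1|]; last by ring.
  rewrite -(ler_pM2l (_ : 0 < s ^+ 2)) ?exprn_gt0//.
  have -> : s ^+ 2 * (2 * K2 * s) = K2 * s ^+ 3 + K2 * s ^+ 3 by ring.
  apply: le_trans (lerD h1 h2); apply: le_trans (ler_normD _ _).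
  rewrite -[X in X * _]ger0_norm ?sqr_ge0// -normrM le_eqVlt; apply/orP; left.
  by apply/eqP; congr (`|_|); field.
have ve : v = 1 by apply/eqP; rewrite -subr_eq0 -normr_le0.
split => //; apply/eqP; rewrite -normr_le0.
apply: (@le0_of_linear _ K2) => s s0 s1.
have := bE s; rewrite ve subrr mulr0 addr0 gtr0_norm// => /(_ s1).
rewrite normrM gtr0_norm// exprS mulrCA ler_pM2l// => h.
apply: (le_trans h); rewrite ler_wpM2l//.
  by rewrite /K2 /K addr_ge0 ?mulr_ge0 ?expR_ge0.
by rewrite expr2 ler_piMl// ltW.
Qed.

End gaussian.

(** * Lindeberg's method *)

Section smooth3.
Context {R : realType}.
Implicit Types (u a b h : R -> R) (s K : R).

(* Second-order Taylor expansion with cubic remainder; unlike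
   differentiability, it is visibly stable under averaging over translations. *)
Record smooth3 (K2 K : R) u a b : Prop := Smooth3 {
  smooth3_a : forall x y, `|a x - a y| <= K2 * `|x - y| ;
  smooth3_b : forall x y, `|b x - b y| <= K * `|x - y| ;
  smooth3_bound : forall x, `|b x| <= K2 ;
  smooth3_taylor2 : forall x y, `|u (x + y) - u x - y * a x| <= K2 * y ^+ 2 ;
  smooth3_taylor3 : forall x y,
    `|u (x + y) - u x - y * a x - y ^+ 2 / 2 * b x| <= K * `|y| ^+ 3 }.

Lemma lip_continuous u K : (forall x y, `|u x - u y| <= K * `|x - y|) -> continuous u.
Proof.
move=> uK x; apply/cvgrPdist_le => e e0; near=> y.
apply: (le_trans (uK x y)).
apply: (@le_trans _ _ ((`|K| + 1) * `|x - y|)).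
  by rewrite ler_wpM2r// (le_trans (ler_norm K))// lerDl.
rewrite mulrC -ler_pdivlMr ?ltr_wpDl//.
near: y; apply: cvgr_dist_le => //; by rewrite divr_gt0// ltr_wpDl.
Unshelve. all: by end_near. Qed.

Lemma smooth3_continuous K2 K u a b : smooth3 K2 K u a b -> continuous u.
Proof.
move=> S x; apply/cvgrPdist_le => e e0.
(* A Lipschitz constant at [x] for increments of size at most 1; the summand 1 keeps it positive. *)
pose M : R := `|a x| + `|K2| + 1.
have M0 : 0 < M by rewrite ltr_wpDl// addr_ge0.
near=> y; have y1 : `|x - y| <= 1 by near: y; exact: cvgr_dist_le.
have y2 : `|x - y| <= e / M.
  by near: y; apply: cvgr_dist_le => //; rewrite divr_gt0.
have yE : x + (y - x) = y by rewrite addrC subrK.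
have := smooth3_taylor2 S x (y - x); rewrite yE => h.
have h2 : `|u y - u x| <= `|y - x| * `|a x| + K2 * (y - x) ^+ 2.
  have -> : u y - u x = (u y - u x - (y - x) * a x) + (y - x) * a x by ring.
  by apply: (le_trans (ler_normD _ _)); rewrite addrC normrM lerD2l.
rewrite distrC (le_trans h2)//.
apply: (@le_trans _ _ (`|x - y| * M)); last by rewrite -ler_pdivlMr.
rewrite (distrC y x) -[(y - x) ^+ 2]real_normK ?num_real// (distrC y x) /M.
move: (normr_ge0 (x - y)) y1; move: `|x - y| => r r0 r1.
have KK : K2 <= `|K2| := ler_norm K2.
have := normr_ge0 K2; move: `|K2| KK => N KN N0.
have h3 : K2 * r ^+ 2 <= N * r.
  apply: (@le_trans _ _ (N * r ^+ 2)); first by rewrite ler_wpM2r ?sqr_ge0.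
  by rewrite ler_wpM2l// expr2 ler_piMl.
by apply: le_trans (lerD (lexx _) h3) _; rewrite !mulrDr mulr1 [N * r]mulrC lerDl.
Unshelve. all: by end_near. Qed.

Lemma smooth3_deriv h h1 h2 h3 (K2 K : R) : has_deriv h h1 -> has_deriv h1 h2 ->
  has_deriv h2 h3 -> (forall x, `|h2 x| <= K2) -> (forall x, `|h3 x| <= K) ->
  smooth3 K2 K h h1 h2.
Proof.
move=> d1 d2 d3 b2 b3; split => //.
- exact: lip_of_deriv d2 b2.
- exact: lip_of_deriv d3 b3.
- by move=> x y; apply: taylor2 d1 d2 _.
- by move=> x y; apply: taylor3 d1 d2 d3 _.
Qed.

Lemma smooth3_intg d (T : measurableType d) (P : probability T R) K2 K u a b (Z : T -> R) :
  smooth3 K2 K u a b -> sqint P Z -> intg P (fun w => u (Z w)).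
Proof.
move=> S sZ.
apply: (@intg_le _ _ _ P _ (fun w => `|u 0| + (`|a 0| * `|Z w| + K2 * Z w ^+ 2))).
- apply: measurableT_comp; last exact: sZ.1.
  exact: continuous_measurable_fun (smooth3_continuous S).
- move=> w; have := smooth3_taylor2 S 0 (Z w); rewrite add0r => h.
  have -> : u (Z w) = u 0 + (Z w * a 0 + (u (Z w) - u 0 - Z w * a 0)) by ring.
  apply: (le_trans (ler_normD _ _)); rewrite lerD2l.
  apply: (le_trans (ler_normD _ _)); apply: lerD => //.
  by rewrite normrM mulrC.
- apply: intgD; first exact: intg_cst.
  apply: intgD; last by apply: intgZ; exact: sZ.2.
  by apply: intgZ; apply: intg_norm; exact: sqint_intg sZ.
Qed.

Definition gaussG s u x := \int[normal_prob (0 : R) 1]_z u (x + s * z).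

Lemma gaussG0 u : gaussG 0 u = u.
Proof.
apply/funext => x; rewrite /gaussG; under eq_Rintegral do rewrite mul0r addr0.
by rewrite Rint_cst.
Qed.

Lemma shift_sqint x s : sqint (normal_prob (0 : R) 1) (fun z => x + s * z).
Proof.
by apply: sqintD; [exact: sqint_cst|apply: sqintZ; exact: normal_sqint].
Qed.

Lemma smooth3_gaussG s K2 K u a b : smooth3 K2 K u a b ->
  smooth3 K2 K (gaussG s u) (gaussG s a) (gaussG s b).
Proof.
move=> S.
have cu := smooth3_continuous S.
have ca := lip_continuous (smooth3_a S).
have cb := lip_continuous (smooth3_b S).
have Iu x : intg (normal_prob (0 : R) 1) (fun z => u (x + s * z)).
  exact: smooth3_intg S (shift_sqint x s).
have Ia x : intg (normal_prob (0 : R) 1) (fun z => a (x + s * z)).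
  apply: sqint_intg; exact: sqint_lip ca (smooth3_a S) (shift_sqint x s).
have Ib x : intg (normal_prob (0 : R) 1) (fun z => b (x + s * z)).
  apply: sqint_intg; exact: sqint_lip cb (smooth3_b S) (shift_sqint x s).
have le (f : R -> R) (c : R) : intg (normal_prob (0 : R) 1) f -> (forall z, `|f z| <= c) ->
    `|\int[normal_prob (0 : R) 1]_z f z| <= c.
  move=> If fc; rewrite -[leRHS](Rint_cst (normal_prob (0 : R) 1)).
  by apply: Rint_abs_le => //; [exact: intg_measurable If|exact: intg_cst].
have sh x y z : x + y + s * z = x + s * z + y by ring.
split.
- move=> x y; rewrite /gaussG -RintB//; apply: le; first exact: intgB.
  move=> z; apply: (le_trans (smooth3_a S _ _)).
  by rewrite (_ : _ - _ = x - y)//; ring.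
- move=> x y; rewrite /gaussG -RintB//; apply: le; first exact: intgB.
  move=> z; apply: (le_trans (smooth3_b S _ _)).
  by rewrite (_ : _ - _ = x - y)//; ring.
- by move=> x; apply: le => // z; exact: smooth3_bound S _.
- move=> x y; rewrite /gaussG -RintB// -RintZ// -RintB//; last 2 first.
  + exact: intgB.
  + exact: intgZ.
  apply: le; first by apply: intgB; [exact: intgB|exact: intgZ].
  by move=> z; rewrite sh; exact: smooth3_taylor2 S _ _.
- move=> x y; rewrite /gaussG -RintB// -!RintZ// -RintB//; last 2 first.
  + exact: intgB.
  + exact: intgZ.
  rewrite -RintB//; last 2 first.
  + by apply: intgB; [exact: intgB|exact: intgZ].
  + exact: intgZ.
  apply: le.
    by apply: intgB; [apply: intgB; [exact: intgB|exact: intgZ]|exact: intgZ].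
  by move=> z; rewrite sh; exact: smooth3_taylor3 S _ _.
Qed.

Lemma gaussG_comp s (r c : R) K2 K u a b : 0 < s -> 0 <= r -> 0 < c ->
  c ^+ 2 = r ^+ 2 + s ^+ 2 -> smooth3 K2 K u a b ->
  gaussG s (gaussG r u) = gaussG c u.
Proof.
move=> s0 r0 c0 csa S.
(* [gauss_stable] requires positive deviations, so a vanishing first smoothing is treated
   separately; it occurs at the start of the replacement. *)
move: r0; rewrite le_eqVlt => /orP[/eqP r0|r0].
  rewrite -r0 gaussG0; congr (gaussG _ u).
  move: csa; rewrite -r0 expr0n /= add0r => /(congr1 Num.sqrt).
  by rewrite !sqrtr_sqr !gtr0_norm.
apply/funext => x; rewrite /gaussG.
have cu : continuous (fun w => u (x + w)).
  move=> w; apply: (@continuous_comp _ _ _ (fun w => x + w) u); last exact: smooth3_continuous S _.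
  by apply: continuousD; [exact: cvg_cst|exact: cvg_id].
have [I2 e2] := gauss_stable r0 s0 c0 csa cu (smooth3_intg S (shift_sqint x c)).
rewrite -e2 (Rint_prod_iter I2).2; apply: eq_Rintegral => y _.
by apply: eq_Rintegral => z _; rewrite addrA.
Qed.

Definition m3 : R := \int[normal_prob (0 : R) 1]_x (`|x| ^+ 3).

Lemma m3_ge0 : 0 <= m3.
Proof. by apply: Rintegral_ge0 => x _; exact: exprn_ge0. Qed.

(** The Taylor expansion is integrated in the Gaussian variable: mean 0 removes the linear term, and
    variance 1 fixes the quadratic one. *)
Lemma gaussG_expand s K2 K u a b (x : R) : 0 <= s -> smooth3 K2 K u a b ->
  `|gaussG s u x - u x - s ^+ 2 / 2 * b x| <= K * (s ^+ 3 * m3).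
Proof.
move=> s0 S.
have [e1 e2] := @normal_moments R.
have I1 := sqint_intg (@normal_sqint R); have I2 := (@normal_sqint R).2.
have Iu : intg (normal_prob (0 : R) 1) (fun z => u (x + s * z)).
  exact: smooth3_intg S (shift_sqint x s).
have -> : gaussG s u x - u x - s ^+ 2 / 2 * b x =
   \int[normal_prob (0 : R) 1]_z (u (x + s * z) - u x - (s * a x) * z - (s ^+ 2 / 2 * b x) * z ^+ 2).
  rewrite RintB; last 2 first.
  - by apply: intgB; [apply: intgB; [exact: Iu|exact: intg_cst]|exact: intgZ].
  - exact: intgZ.
  rewrite RintB; last 2 first.
  - by apply: intgB; [exact: Iu|exact: intg_cst].
  - exact: intgZ.
  rewrite RintB; [|exact: Iu|exact: intg_cst].
  by rewrite !RintZ// Rint_cst e1 e2 mulr0 mulr1 subr0.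
rewrite /m3 mulrA -RintZ; last exact: normal_intg_norm3.
apply: Rint_abs_le.
- apply: (intg_measurable (mu := normal_prob (0 : R) 1)).
  apply: intgB; last exact: intgZ.
  by apply: intgB; [apply: intgB; [exact: Iu|exact: intg_cst]|exact: intgZ].
- by apply: intgZ; exact: normal_intg_norm3.
move=> z; have := smooth3_taylor3 S x (s * z).
rewrite normrM exprMn (ger0_norm s0) mulrA exprMn; congr (`|_ - _ - _| <= _); ring.
Qed.

End smooth3.

Section lindeberg.
Context {R : realType} {n : nat}.
Local Notation E := (space R n).
Variables (mu : probability E R) (nu : probability R R).
Hypothesis iid : iid_law mu nu.
Implicit Types A B : {set 'I_n}.
Variables (l : R -> R) (beta : R).
Hypothesis n_gt0 : (0 < n)%N.
Hypothesis ml : measurable_fun [set: R] l.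
Hypothesis l_mean : \int[nu]_y l y = 0.
Hypothesis l_var : \int[nu]_y (l y ^+ 2) = n%:R^-1.
Hypothesis l_intg3 : intg nu (fun y => `|l y| ^+ 3).
Hypothesis l_third : n%:R * \int[nu]_y (`|l y| ^+ 3) = beta.

(** Independence from [Z] and equality of the first two moments give both integrals the same
    expansion up to second order, so only the two cubic remainders are left. The Gaussian summand is
    present only as the averaging in [gaussG]. *)
Lemma lindeberg_swap A i (Z : E -> R) s (K2 K : R) u a b : i \notin A ->
  depends_on A Z -> sqint mu Z -> 0 <= s -> s ^+ 2 = n%:R^-1 -> smooth3 K2 K u a b ->
  `|\int[mu]_x u (Z x + l (x i)) - \int[mu]_x gaussG s u (Z x)| <=
    K * (\int[nu]_y (`|l y| ^+ 3) + s ^+ 3 * m3).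
Proof.
move=> iA dZ sZ s0 s2 S.
have sl := coord_l_sqint iid ml l_intg3 i.
have Il2 := l_intg2 ml l_intg3; have Il := l_intg ml l_intg3.
have IuZ : intg mu (fun x => u (Z x)) := smooth3_intg S sZ.
have IuZl : intg mu (fun x => u (Z x + l (x i))) := smooth3_intg S (sqintD sZ sl).
have Ig : intg mu (fun x => gaussG s u (Z x)) := smooth3_intg (smooth3_gaussG s S) sZ.
have IaZ : intg mu (fun x => a (Z x)).
  exact: sqint_intg (sqint_lip (lip_continuous (smooth3_a S)) (smooth3_a S) sZ).
have IbZ : intg mu (fun x => b (Z x)).
  exact: sqint_intg (sqint_lip (lip_continuous (smooth3_b S)) (smooth3_b S) sZ).
have dAi : {in A, forall j, j \notin [set i]%SET}.
  by move=> j jA; rewrite inE; apply: contraNneq iA => <-.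
have dep (v : R -> R) : depends_on A (fun x => v (Z x)) by move=> x y xy; rewrite (dZ x y xy).
have dli (v : R -> R) : depends_on [set i]%SET (fun x : E => v (l (x i))).
  by move=> x y xy; rewrite xy// inE.
have [I1 e1] := indep_intg iid dAi (dep a) (dli id) IaZ (sqint_intg sl).
have [I2 e2] := indep_intg iid dAi (dep b) (dli (fun y => y ^+ 2)) IbZ sl.2.
move: e1 e2; rewrite /= (coord_Rint iid i Il) (coord_Rint iid i Il2) l_mean l_var mulr0.
move=> e1 e2.
have I3 : intg mu (fun x : E => `|l (x i)| ^+ 3) := coord_intg iid i l_intg3.
have E1 : `|\int[mu]_x u (Z x + l (x i)) - \int[mu]_x u (Z x) -
    2^-1 * (\int[mu]_x b (Z x) * n%:R^-1)| <= K * \int[nu]_y (`|l y| ^+ 3).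
  rewrite -(coord_Rint iid i l_intg3) -RintZ// -e2 -RintZ// -[X in `|X - _|]subr0 -{1}e1.
  rewrite -RintB// -RintB//; last exact: intgB.
  rewrite -RintB//; [|by apply: intgB => //; exact: intgB|exact: intgZ].
  apply: Rint_abs_le.
  - apply: (intg_measurable (mu := mu)); apply: intgB; last exact: intgZ.
    by apply: intgB => //; exact: intgB.
  - exact: intgZ.
  move=> x; have := smooth3_taylor3 S (Z x) (l (x i)).
  by congr (`|_ - _ - _| <= _); ring.
have E2 : `|\int[mu]_x gaussG s u (Z x) - \int[mu]_x u (Z x) -
    2^-1 * (\int[mu]_x b (Z x) * n%:R^-1)| <= K * (s ^+ 3 * m3).
  rewrite -RintB// mulrC -mulrA mulrC -RintZ// -RintB//; [|exact: intgB|exact: intgZ].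
  rewrite -[leRHS](Rint_cst mu); apply: Rint_abs_le.
  - apply: (intg_measurable (mu := mu)); apply: intgB; last exact: intgZ.
    exact: intgB.
  - exact: intg_cst.
  by move=> x; rewrite -s2; exact: gaussG_expand s0 S.
rewrite mulrDr; move: E1 E2; rewrite !ler_norml.
by move=> /andP[? ?] /andP[? ?]; apply/andP; split; lra.
Qed.

Lemma Lsum_initialS j (ji : (j < n)%N) (x : E) :
  Lsum l (initial_set n j.+1) x = Lsum l (initial_set n j) x + l (x (Ordinal ji)).
Proof.
rewrite /Lsum (bigD1 (Ordinal ji))/=; last by rewrite inE.
rewrite addrC; congr (_ + _); apply: eq_bigl => i; rewrite !inE ltnS leq_eqVlt.
have -> : (i == Ordinal ji) = (i == j :> nat) by [].
by case: ltngtP.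
Qed.

Lemma lindeberg h h1 h2 h3 (K2 K : R) : has_deriv h h1 -> has_deriv h1 h2 ->
  has_deriv h2 h3 -> (forall x, `|h2 x| <= K2) -> (forall x, `|h3 x| <= K) ->
  `|\int[mu]_x h (LE l x) - gaussE h| <= K * (1 + m3) * beta.
Proof.
move=> d1 d2 d3 b2 b3; have S := smooth3_deriv d1 d2 d3 b2 b3.
have K0 : 0 <= K := le_trans (normr_ge0 _) (b3 0).
pose s : R := (Num.sqrt n%:R)^-1.
have sn0 : 0 < Num.sqrt n%:R :> R by rewrite sqrtr_gt0 nR_gt0.
have s0 : 0 < s by rewrite invr_gt0.
have s2 : s ^+ 2 = n%:R^-1 by rewrite exprVn sqr_sqrtr// ler0n.
(* [h] averaged over the sum of [j] independent Gaussian summands of variance [1 / n]. *)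
pose v j : R -> R := gaussG (s * Num.sqrt j%:R) h.
have vS j : gaussG s (v j) = v j.+1.
  apply: gaussG_comp S => //.
  - by rewrite mulr_ge0// ltW.
  - by rewrite mulr_gt0// sqrtr_gt0 ltr0n.
  - by rewrite !exprMn !sqr_sqrtr ?ler0n// -natr1 mulrDr mulr1.
pose e := K * (\int[nu]_y (`|l y| ^+ 3) + s ^+ 3 * m3).
(* Summands are replaced from the last index downwards; after [m] replacements those of index below
   [n - m] remain. *)
have step m : (m <= n)%N ->
    `|\int[mu]_x h (LE l x) - \int[mu]_x v m (Lsum l (initial_set n (n - m)) x)| <= m%:R * e.
  elim: m => [_|m IH mn].
    rewrite subn0 /v sqrtr0 mulr0 gaussG0 mul0r.
    rewrite (_ : \int[mu]_x h (LE l x) = \int[mu]_x h (Lsum l (initial_set n n) x)).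
      by rewrite subrr normr0.
    apply: eq_Rintegral => x _; congr h; apply: eq_bigl => i.
    by rewrite inE ltn_ord.
  have jn : (n - m.+1 < n)%N by rewrite ltn_subrL n_gt0.
  have nm : (n - m = (n - m.+1).+1)%N by rewrite subnSK.
  have h1' := IH (ltnW mn); rewrite nm in h1'.
  have := @lindeberg_swap (initial_set n (n - m.+1)) (Ordinal jn)
    (Lsum l (initial_set n (n - m.+1))) s K2 K _ _ _ _ _ _ (ltW s0) s2
    (smooth3_gaussG (s * Num.sqrt m%:R) S).
  rewrite -/(v m) vS -/e => /(_ _ _ _) h2'.
  rewrite (_ : \int[mu]_x v m (Lsum l (initial_set n (n - m.+1).+1) x) =
    \int[mu]_x v m (Lsum l (initial_set n (n - m.+1)) x + l (x (Ordinal jn)))) in h1'; last first.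
    by apply: eq_Rintegral => x _; rewrite (Lsum_initialS jn).
  rewrite -natr1 mulrDl mul1r; apply: le_trans (lerD h1' (h2' _ _ _)).
  - rewrite -[X in `|X| <= _](subrKA (\int[mu]_x v m (Lsum l (initial_set n (n - m.+1)) x + l (x (Ordinal jn))))).
    exact: ler_normD.
  - by rewrite inE ltnn.
  - exact: depends_on_Lsum.
  - exact: (Lsum_sqint iid ml l_intg3 _).
have := step n (leqnn n); rewrite subnn.
have -> : \int[mu]_x v n (Lsum l (initial_set n 0) x) = gaussE h.
  rewrite -[RHS](Rint_cst mu); apply: eq_Rintegral => x _.
  rewrite /Lsum big1; last by move=> i; rewrite inE.
  rewrite /v /s mulVf ?gt_eqF// /gaussG /gaussE; congr fine.
  by apply: eq_integral => z _; rewrite mul1r add0r.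
move/le_trans; apply; rewrite /e mulrCA -mulrA ler_wpM2l//.
rewrite mulrDr l_third mulrDl mul1r lerD2l mulrA mulrC ler_wpM2l ?m3_ge0//.
(* Here [n * s ^+ 3] reduces to [s], the inverse square root of [n], which [beta_ge] bounds. *)
rewrite exprSr s2 mulrA mulfV ?mul1r ?gt_eqF ?nR_gt0//.
exact: beta_ge ml l_var l_intg3 l_third.
Qed.

(** For [beta] at least 1 the trivial bound [2 * C] suffices; otherwise the missing summands are
    restored at Lipschitz cost and [lindeberg] applies. The minimum is kept because its square is at
    most [beta]. *)
Lemma lindeberg_partial A h h1 h2 h3 (C K2 : R) : has_deriv h h1 -> has_deriv h1 h2 ->
  has_deriv h2 h3 -> (forall x, `|h x| <= C) -> (forall x, `|h1 x| <= C) ->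
  (forall x, `|h2 x| <= K2) -> (forall x, `|h3 x| <= C) ->
  `|\int[mu]_x h (Lsum l (~: A)%SET x) - gaussE h| <=
    C * (#|A|%:R + 2 + m3) * Num.min 1 beta.
Proof.
move=> d1 d2 d3 b0 b1 b2 b3.
have C0 : 0 <= C := le_trans (normr_ge0 _) (b3 0).
have S := smooth3_deriv d1 d2 d3 b2 b3.
have beta0 : 0 < beta := beta_gt0 n_gt0 ml l_var l_intg3 l_third.
have A0 : 0 <= #|A|%:R :> R by rewrite ler0n.
have m30 : 0 <= m3 :> R := m3_ge0.
have sq1 := Lsum_sqint iid ml l_intg3 (~: A)%SET.
have sqL := LE_sqint iid ml l_intg3.
have I1 : intg mu (fun x => h (Lsum l (~: A)%SET x)) := smooth3_intg S sq1.
have I2 : intg mu (fun x => h (LE l x)) := smooth3_intg S sqL.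
have IA : intg mu (fun x => `|Lsum l A x|).
  exact: (intg_norm (sqint_intg (Lsum_sqint iid ml l_intg3 A))).
have [b1'|b1'] := leP 1 beta.
  rewrite mulr1; apply: (@le_trans _ _ (C + C)).
    apply: (le_trans (ler_normB _ _)); apply: lerD.
      rewrite -[leRHS](Rint_cst mu); apply: Rint_abs_le => //.
      - exact: intg_measurable I1.
      - exact: intg_cst.
    rewrite -[leRHS](Rint_cst (normal_prob (0 : R) 1)); apply: Rint_abs_le => //.
    - exact: continuous_measurable_fun (has_deriv_cont d1).
    - exact: intg_cst.
  rewrite (_ : C + C = C * 2); last by ring.
  by rewrite ler_wpM2l//; lra.
have hL := lindeberg d1 d2 d3 b2 b3.
have hA : `|\int[mu]_x h (Lsum l (~: A)%SET x) - \int[mu]_x h (LE l x)| <= C * (#|A|%:R * beta).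
  rewrite -RintB//; apply: le_trans (_ : \int[mu]_x (C * `|Lsum l A x|) <= _).
    apply: Rint_abs_le.
    - by apply: (intg_measurable (mu := mu)); exact: intgB.
    - exact: intgZ.
    move=> x; apply: (le_trans (lip_of_deriv d1 b1 _ _)).
    rewrite ler_wpM2l// distrC.
    have -> : LE l x = Lsum l A x + Lsum l (~: A)%SET x.
      rewrite /LE (bigID (mem A))/=; congr (_ + _).
      by apply: eq_bigl => i; rewrite inE.
    by rewrite addrK.
  rewrite RintZ// ler_wpM2l//.
  exact: (Rint_abs_Lsum iid n_gt0 ml l_var l_intg3 l_third A).
rewrite -[X in `|X| <= _](subrKA (\int[mu]_x h (LE l x))).
apply: (le_trans (ler_normD _ _)); apply: (le_trans (lerD hA hL)).
rewrite -subr_ge0 (_ : _ - _ = C * beta); last by ring.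
by rewrite mulr_ge0// ltW.
Qed.

End lindeberg.

(** * The expansion *)

Section expansion.
Context {R : realType} {n k : nat}.
Local Notation E := (space R n).
Variables (mu : probability E R) (nu : probability R R).
Hypothesis iid : iid_law mu nu.
Variable t : forall p : nat, ('I_p -> R) -> R.
Hypothesis t_sym : forall p, symmetric_fun (t (p := p)).
Hypothesis t_intg : forall p, (1 <= p <= k)%N -> (p <= n)%N ->
  intg mu (tA t (initial_set n p)).
Hypothesis t_deg : forall p, (1 <= p <= k)%N -> (p <= n)%N ->
  forall D : set E, measurable D ->
  depends_on [set j : 'I_n | (1 <= j < p)%N]%SET D ->
  \int[mu]_x (tA t (initial_set n p) x * \1_D x) = 0.
Variables (l : R -> R) (beta : R).
Hypothesis n_gt0 : (0 < n)%N.
Hypothesis ml : measurable_fun [set: R] l.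
Hypothesis l_mean : \int[nu]_y l y = 0.
Hypothesis l_var : \int[nu]_y (l y ^+ 2) = n%:R^-1.
Hypothesis l_intg3 : intg nu (fun y => `|l y| ^+ 3).
Hypothesis l_third : n%:R * \int[nu]_y (`|l y| ^+ 3) = beta.
Local Notation tA := (tA t).
Local Notation TE := (@TE R n k t).
Local Notation Lprod := (Lprod l).
Local Notation Lsum := (Lsum l).
Local Notation LE := (LE l).
Implicit Types A B : {set 'I_n}.
Hypothesis TE_sq : sqint mu TE.

Let tA_sq A : (0 < #|A| <= k)%N -> sqint mu (tA A).
Proof. exact: (tA_sqint iid t_sym t_intg t_deg TE_sq). Qed.

Let Lprod_sq A : sqint mu (Lprod A).
Proof. exact: (Lprod_sqint iid ml l_var l_intg3 A). Qed.

Let Lsum_sq A : sqint mu (Lsum A).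
Proof. exact: (Lsum_sqint iid ml l_intg3 A). Qed.

Let coord_sq i : sqint mu (fun x : E => l (x i)).
Proof. exact: (coord_l_sqint iid ml l_intg3 i). Qed.

Let LE_sq : sqint mu LE.
Proof. exact: (LE_sqint iid ml l_intg3). Qed.

(** An index of [B] outside [A] is killed by degeneracy. If [B] lies strictly inside [A], a spare
    factor [l (x i)] is independent of the rest and has mean zero. *)
Lemma Rint_Lprod_tA0 A B : (0 < #|B| <= k)%N -> B != A ->
  \int[mu]_x (Lprod A x * tA B x) = 0.
Proof.
move=> Bk BA; have [sBA|/exists_diff[i iB iA]] := boolP (B \subset A).
  have /exists_diff[i iA iB] : ~~ (A \subset B).
    by apply: contraNN BA => sAB; rewrite finset.eqEsubset sBA.
  pose V x := Lprod (A :\ i)%SET x * tA B x.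
  have IV : intg mu V by apply: intgM; [exact: Lprod_sq|exact: tA_sq].
  have dV : depends_on (~: [set i])%SET V.
    move=> x y xy; congr (_ * _).
      apply: depends_on_Lprod => j; rewrite in_setD1 => /andP[ji _].
      by apply: xy; rewrite !inE.
    apply: depends_on_tA => j jB; apply: xy; rewrite !inE.
    by apply: contraNneq iB => <-.
  have di : {in [set i]%SET, forall j, j \notin (~: [set i])%SET}.
    by move=> j; rewrite !inE negbK.
  have dl : depends_on [set i]%SET (fun x : E => l (x i)).
    by move=> x y xy; rewrite xy// inE.
  have [_ e] := indep_intg iid di dl dV (sqint_intg (coord_sq i)) IV.
  transitivity (\int[mu]_x (l (x i) * V x)).
    by apply: eq_Rintegral => x _; rewrite /Lprod (big_setD1 i)//= -mulrA.
  by rewrite e (coord_Rint iid i (l_intg ml l_intg3)) l_mean mul0r.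
under eq_Rintegral do rewrite mulrC.
apply: (tA_orth iid t_sym t_intg t_deg Bk iB).
  apply: depends_onS (@depends_on_Lprod _ _ l A); apply/fintype.subsetP => j jA.
  by rewrite !inE; apply: contraNneq iA => <-.
by apply: intgM; [exact: tA_sq|exact: Lprod_sq].
Qed.

Lemma Rint_Lprod_TE A : (0 < #|A| <= k)%N ->
  \int[mu]_x (Lprod A x * TE x) = \int[mu]_x (Lprod A x * tA A x).
Proof.
move=> Ak; under eq_Rintegral do rewrite TE_sum mulr_sumr.
rewrite Rint_sum; last by move=> B Bk; apply: intgM; [exact: Lprod_sq|exact: tA_sq].
rewrite (bigD1 A)//= big1 ?addr0// => B /andP[Bk BA].
exact: Rint_Lprod_tA0.
Qed.

Lemma Lprod_permute A s x : Lprod A (permute s x) = Lprod (s @: A)%SET x.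
Proof.
by rewrite /Lprod big_imset//=; move=> i j _ _ /perm_inj.
Qed.

Lemma Rint_Lprod_tA_sym A : (0 < #|A| <= k)%N ->
  \int[mu]_x (Lprod A x * tA A x) =
  \int[mu]_x (Lprod (initial_set n #|A|) x * tA (initial_set n #|A|) x).
Proof.
move=> Ak; have /card_gt0P[i iA] : (0 < #|A|)%N by case/andP: Ak.
have [s [sA _]] := perm_to_initial iA.
have I : intg mu (fun x => Lprod A x * tA A x).
  by apply: intgM; [exact: Lprod_sq|exact: tA_sq].
rewrite -(Rint_permute iid s I); apply: eq_Rintegral => x _.
by rewrite Lprod_permute tA_permute// sA.
Qed.

Definition kappaE p : R :=
  'C(n, p)%:R * \int[mu]_x (Lprod (initial_set n p) x * TE x).

(** By symmetry all sets of size [p] contribute equally, and the binomial coefficient counts them.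
    For [p] above [n] that coefficient is 0 and the sum is empty. *)
Lemma kappaE_sum p : (1 <= p <= k)%N ->
  kappaE p = \sum_(A : {set 'I_n} | #|A| == p) \int[mu]_x (Lprod A x * tA A x).
Proof.
move=> pk; have [pn|np] := leqP p n; last first.
  rewrite /kappaE bin_small// mul0r big1// => A /eqP Ap.
  by have := card_le_n A; rewrite Ap leqNgt np.
have ip := card_initial_set pn.
rewrite (eq_bigr (fun=> \int[mu]_x (Lprod (initial_set n p) x * tA (initial_set n p) x))).
  rewrite sumr_const (_ : #|_| = 'C(n, p)).
    by rewrite /kappaE Rint_Lprod_TE ?ip// mulr_natl.
  by rewrite -[in RHS](card_ord n) -card_draws cardsE.
by move=> A /eqP Ap; rewrite Rint_Lprod_tA_sym Ap.
Qed.

Section remainder.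
Variables (F : nat -> R -> R) (C : R).
Hypothesis F_deriv : forall j, (j < k + 4)%N -> has_deriv (F j) (F j.+1).
Hypothesis F_bound : forall j, (2 <= j <= k + 4)%N -> forall x, `|F j x| <= C.

Let C0 : 0 <= C.
Proof. by apply: le_trans (normr_ge0 _) (F_bound (j := 2) _ 0); rewrite addn4. Qed.

Let F1_deriv : has_deriv (F 1) (F 2).
Proof. by apply: F_deriv; rewrite addn4. Qed.

Let F1_lip x y : `|F 1 x - F 1 y| <= C * `|x - y|.
Proof. by apply: lip_of_deriv F1_deriv _ _ _ => z; apply: F_bound; rewrite addn4. Qed.

(** [F j] stands for the [j]-th derivative of the test function. [F 1] may be unbounded, but its
    Lipschitz property preserves square integrability. *)
Lemma F1_sqint (Z : E -> R) : sqint mu Z -> sqint mu (fun x => F 1 (Z x)).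
Proof. exact: (sqint_lip (has_deriv_cont F1_deriv) F1_lip). Qed.

Lemma mdiff_sqint (s : seq 'I_n) (Z : E -> R) : sqint mu Z ->
  sqint mu (fun x : E => mdiff (F 1) [seq l (x i) | i <- s] (Z x)).
Proof.
elim: s Z => [|i s IH] Z sZ /=; first exact: F1_sqint.
by apply: sqintB; apply: IH => //; exact: (sqintD sZ (coord_sq i)).
Qed.

(** The base point omits the listed summands, so the corner where all increments are added is [LE x]
    itself. *)
Let D (s : seq 'I_n) (x : E) :=
  mdiff (F 1) [seq l (x i) | i <- s] (LE x - \sum_(i <- s) l (x i)).

Let sum_sq (s : seq 'I_n) : sqint mu (fun x : E => LE x - \sum_(i <- s) l (x i)).
Proof. by apply: sqintB LE_sq _; apply: sqint_sum => i _; exact: coord_sq. Qed.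

(* Degeneracy lets one take differences in every variable of [A] for free. *)
Lemma Rint_tA_mdiff A (s : seq 'I_n) : (0 < #|A| <= k)%N -> uniq s -> {subset s <= A} ->
  \int[mu]_x (tA A x * D s x) = \int[mu]_x (tA A x * F 1 (LE x)).
Proof.
move=> Ak; elim: s => [_ _|i s IH /= /andP[si us] sA].
  by apply: eq_Rintegral => x _; rewrite /D big_nil subr0.
(* The part of the new difference in which the summand at [i] is left out: it does not involve
   coordinate [i], so degeneracy annihilates its product with [tA A]. *)
pose W (x : E) := mdiff (F 1) [seq l (x i) | i <- s]
  (LE x - \sum_(j <- i :: s) l (x j)).
have sW : sqint mu W by apply: mdiff_sqint; exact: sum_sq.
have sD : sqint mu (D s) by apply: mdiff_sqint; exact: sum_sq.
have e x : D (i :: s) x = D s x - W x.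
  rewrite /D /W /= big_cons; congr (mdiff _ _ _ - _); ring.
under eq_Rintegral do rewrite e mulrBr.
have sAk := tA_sq Ak.
rewrite RintB; [|exact: intgM|exact: intgM].
rewrite IH//; last by move=> j js; apply: sA; rewrite inE js orbT.
suff -> : \int[mu]_x (tA A x * W x) = 0 by rewrite subr0.
apply: (tA_orth iid t_sym t_intg t_deg Ak (sA i (mem_head _ _))); last exact: intgM.
move=> x y xy; rewrite /W.
have -> : [seq l (x j) | j <- s] = [seq l (y j) | j <- s].
  apply/eq_in_map => j js; rewrite xy// !inE.
  by apply: contraNneq si => <-.
congr mdiff; rewrite !big_cons /LE (bigD1 i)//= [in RHS](bigD1 i)//=.
rewrite !opprD !addrA ![l _ + _ - l _]addrAC !subrr !add0r; congr (_ - _).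
  by apply: eq_bigr => j ji; rewrite xy// !inE.
rewrite !big_seq; apply: eq_bigr => j js; rewrite xy// !inE.
by apply: contraNneq si => <-.
Qed.

Let compl_sum A x : LE x - \sum_(i <- enum A) l (x i) = Lsum (~: A)%SET x.
Proof.
rewrite big_enum /LE (bigID (mem A))/= addrAC subrr add0r.
by apply: eq_bigl => i; rewrite inE.
Qed.

Lemma mdiff_remainder A x : (0 < #|A| <= k)%N ->
  `|tA A x * (D (enum A) x - Lprod A x * F #|A|.+1 (Lsum (~: A)%SET x))| <=
  C * (tA A x ^+ 2 + 2 * \sum_(i in A) (Lprod A x ^+ 2 * `|l (x i)|)).
Proof.
move=> Ak; have [A0 Ak'] := andP Ak.
have [||xi [hxi e]] := @mdiff_mvt _ (fun j => F j.+1) (k + 3)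
   [seq l (x i) | i <- enum A] (Lsum (~: A)%SET x).
- by move=> j jk; apply: F_deriv; lia.
- by rewrite size_map -cardE (leq_trans Ak')// leq_addr.
rewrite /D compl_sum e size_map -cardE big_map big_enum -/(Lprod A x).
rewrite -mulrBr; set z := Lsum _ _.
set S := \sum_(i in A) `|l (x i)|.
have hS : `|xi - z| <= S by move: hxi; rewrite big_map big_enum.
have S0 : 0 <= S by apply: sumr_ge0.
have b1 : `|F #|A|.+1 xi - F #|A|.+1 z| <= C * S.
  apply: le_trans (_ : C * `|xi - z| <= _); last by rewrite ler_wpM2l.
  apply: lip_of_deriv (F_deriv _) _ _ _; first by lia.
  by move=> y; apply: F_bound; lia.
have b2 : `|F #|A|.+1 xi - F #|A|.+1 z| <= C * 2.
  have hb y : `|F #|A|.+1 y| <= C.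
    by apply: F_bound; lia.
  by have := lerD (hb xi) (hb z); have := ler_normB (F #|A|.+1 xi) (F #|A|.+1 z); lra.
(* The trivial bound [2 * C] and the Lipschitz bound [C * S] are combined so that [w ^+ 2] is at
   most [2 * S]; squaring [S] itself would call for fourth moments of [l]. *)
pose w := Num.min 2 S.
have w0 : 0 <= w by rewrite le_min S0 ler0n.
have w2 : w ^+ 2 <= 2 * S.
  by rewrite expr2; apply: ler_pM => //; rewrite ge_min lexx ?orbT.
have bw : `|F #|A|.+1 xi - F #|A|.+1 z| <= C * w.
  by rewrite /w /Num.min; case: ifP.
rewrite -mulr_sumr -/S !normrM.
apply: (@le_trans _ _ (`|tA A x| * (`|Lprod A x| * (C * w)))).
  by rewrite !ler_wpM2l.
rewrite (_ : _ * (_ * (C * w)) = C * (`|tA A x| * (`|Lprod A x| * w))); last by ring.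
rewrite ler_wpM2l//.
rewrite -[tA A x ^+ 2]real_normK ?num_real// -[Lprod A x ^+ 2]real_normK ?num_real//.
apply: (@le_trans _ _ (`|tA A x| ^+ 2 + (`|Lprod A x| * w) ^+ 2)).
  have := sqr_ge0 (`|tA A x| - `|Lprod A x| * w).
  have := mulr_ge0 (normr_ge0 (tA A x)) (mulr_ge0 (normr_ge0 (Lprod A x)) w0).
  lra.
by rewrite lerD2l exprMn [leRHS]mulrCA ler_wpM2l ?sqr_ge0.
Qed.

(** The constant of [lindeberg_partial], with the cardinal of [A] bounded by [k]. *)
Let c1 : R := k%:R + 2 + m3.

Let delta : R := Num.min 1 beta.

Let beta0 : 0 < beta.
Proof. exact: (beta_gt0 n_gt0 ml l_var l_intg3 l_third). Qed.

Let delta0 : 0 <= delta.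
Proof. by rewrite le_min ler01 ltW. Qed.

Let delta2 : delta ^+ 2 <= beta.
Proof. by rewrite expr2 -[leRHS]mul1r; apply: ler_pM => //; rewrite ge_min lexx ?orbT. Qed.

Let gE p : R := gaussE (F p.+1).

Lemma chaos_term A : (0 < #|A| <= k)%N ->
  `|\int[mu]_x (tA A x * F 1 (LE x)) - \int[mu]_x (Lprod A x * tA A x) * gE #|A| | <=
  C * (1 + c1) * \int[mu]_x (tA A x ^+ 2) +
  C * (2 * #|A|%:R + c1) * (beta * n%:R^-1 ^+ #|A|).
Proof.
move=> Ak; have [A0 Ak'] := andP Ak.
have sT := tA_sq Ak; have sP := Lprod_sq A.
pose p := #|A|; pose h := F p.+1.
have hb y : `|h y| <= C.
  by apply: F_bound; rewrite /p; lia.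
have pk4 j : (j <= 3)%N -> (p + j < k + 4)%N.
  by rewrite /p; lia.
have dh : has_deriv h (F p.+2) by apply: F_deriv; rewrite -addn1; exact: pk4.
have dh1 : has_deriv (F p.+2) (F p.+3) by apply: F_deriv; rewrite -addn2; exact: pk4.
have dh2 : has_deriv (F p.+3) (F p.+4) by apply: F_deriv; rewrite -addn3; exact: pk4.
have Fb j : (1 <= j <= 4)%N -> forall y, `|F (p + j)%N y| <= C.
  by move=> j4 y; apply: F_bound; rewrite /p; lia.
have b1 y : `|F p.+2 y| <= C by rewrite -addn2; exact: Fb.
have b2 y : `|F p.+3 y| <= C by rewrite -addn3; exact: Fb.
have b3 y : `|F p.+4 y| <= C by rewrite -addn4; exact: Fb.
have mh : measurable_fun [set: R] h := continuous_measurable_fun (has_deriv_cont dh).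
have mhL : measurable_fun [set: E] (fun x => h (Lsum (~: A)%SET x)).
  by apply: measurableT_comp => //; exact: (Lsum_sq _).1.
have Ih : intg mu (fun x => h (Lsum (~: A)%SET x)) := intg_bounded mu mhL (fun x => hb _).
have ITP : intg mu (fun x => tA A x * Lprod A x) := intgM sT sP.
have dTP : depends_on A (fun x => tA A x * Lprod A x).
  by move=> x y xy; congr (_ * _); [exact: depends_on_tA|exact: depends_on_Lprod].
have dhL : depends_on (~: A)%SET (fun x => h (Lsum (~: A)%SET x)).
  by move=> x y xy; congr h; exact: depends_on_Lsum.
have AC : {in A, forall i, i \notin (~: A)%SET} by move=> i; rewrite inE negbK.
have [ITPh eTPh] := indep_intg iid AC dTP dhL ITP Ih.
have sD : sqint mu (D (enum A)) by apply: mdiff_sqint; exact: sum_sq.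
have ITD : intg mu (fun x => tA A x * D (enum A) x) := intgM sT sD.
have [IL2 eL2] := Rint_Lprod2 iid ml l_var l_intg3 A.
have IR2 i : i \in A -> intg mu (fun x => Lprod A x ^+ 2 * `|l (x i)|).
  by move=> iA; exact: (Rint_Lprod2_abs iid n_gt0 ml l_var l_intg3 l_third iA).1.
have eS : \int[mu]_x (\sum_(i in A) (Lprod A x ^+ 2 * `|l (x i)|)) =
    p%:R * (beta * n%:R^-1 ^+ p).
  rewrite Rint_sum//; rewrite (eq_bigr (fun=> beta * n%:R^-1 ^+ p)).
    by rewrite sumr_const mulr_natl.
  by move=> i iA; exact: (Rint_Lprod2_abs iid n_gt0 ml l_var l_intg3 l_third iA).2.
have IS : intg mu (fun x : E => \sum_(i in A) (Lprod A x ^+ 2 * `|l (x i)|)).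
  exact: intg_sum.
(* The intermediate point is moved to the sum over the complement of [A], where independence factors
   the expectation. *)
have part1 : `|\int[mu]_x (tA A x * F 1 (LE x)) -
    \int[mu]_x (tA A x * Lprod A x) * \int[mu]_x h (Lsum (~: A)%SET x)| <=
    C * (\int[mu]_x (tA A x ^+ 2) + 2 * (p%:R * (beta * n%:R^-1 ^+ p))).
  have sub : {subset enum A <= A} by move=> i; rewrite mem_enum.
  rewrite -(Rint_tA_mdiff Ak (enum_uniq A) sub) -eTPh -RintB// -eS -RintZ//.
  rewrite -RintD; [|exact: sT.2|exact: intgZ].
  rewrite -RintZ; last by apply: intgD; [exact: sT.2|exact: intgZ].
  apply: Rint_abs_le.
  - by apply: (intg_measurable (mu := mu)); exact: intgB.
  - by apply: intgZ; apply: intgD; [exact: sT.2|exact: intgZ].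
  by move=> x; rewrite -mulrA -mulrBr; exact: mdiff_remainder.
(* The approximation error [delta] is put on [Lprod A] before splitting: [delta ^+ 2] is at most
   [beta], and [Lprod A] has second moment [n^(-p)]. *)
have part2 : `|\int[mu]_x (tA A x * Lprod A x)| * (C * c1 * delta) <=
    C * c1 * (\int[mu]_x (tA A x ^+ 2) + beta * n%:R^-1 ^+ p).
  have c10 : 0 <= c1 by rewrite /c1 !addr_ge0 ?m3_ge0.
  rewrite [leLHS](_ : _ = C * c1 * (delta * `|\int[mu]_x (tA A x * Lprod A x)|)); last by ring.
  apply: ler_wpM2l; first exact: mulr_ge0.
  apply: (@le_trans _ _ (\int[mu]_x (tA A x ^+ 2 + delta ^+ 2 * Lprod A x ^+ 2))).
    rewrite -[X in X * _]ger0_norm// -normrM -RintZ//.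
    apply: Rint_abs_le.
    - by apply: (intg_measurable (mu := mu)); exact: intgZ.
    - by apply: intgD; [exact: sT.2|exact: intgZ].
    move=> x; rewrite -exprMn normrM (ger0_norm delta0) normrM.
    rewrite -[tA A x ^+ 2]real_normK ?num_real// exprMn -[Lprod A x ^+ 2]real_normK ?num_real//.
    have := sqr_ge0 (`|tA A x| - delta * `|Lprod A x|).
    have := mulr_ge0 (normr_ge0 (tA A x)) (mulr_ge0 delta0 (normr_ge0 (Lprod A x))).
    lra.
  rewrite RintD; [|exact: sT.2|exact: intgZ].
  rewrite lerD2l RintZ// eL2 ler_wpM2r ?exprn_ge0 ?invr_ge0//.
have hL := lindeberg_partial iid n_gt0 ml l_mean l_var l_intg3 l_third A dh dh1 dh2 hb b1 b2 b3.
have hL' : `|\int[mu]_x h (Lsum (~: A)%SET x) - gE p| <= C * c1 * delta.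
  apply: (le_trans hL); rewrite ler_wpM2r// ler_wpM2l// /c1 -!addrA lerD2r ler_nat.
  exact: Ak'.
have -> : \int[mu]_x (Lprod A x * tA A x) = \int[mu]_x (tA A x * Lprod A x).
  by apply: eq_Rintegral => x _; rewrite mulrC.
rewrite -[X in `|X| <= _](subrKA (\int[mu]_x (tA A x * Lprod A x) *
   \int[mu]_x h (Lsum (~: A)%SET x))).
apply: (le_trans (ler_normD _ _)).
rewrite -mulrBr normrM.
apply: le_trans (lerD part1 (le_trans (ler_wpM2l (normr_ge0 _) hL') part2)) _.
rewrite -/p; lra.
Qed.

(** The number of sets of size [p] is outweighed by the factor [n^(-p)] of each error term, so each
    order costs a multiple of [beta] independent of [n]. *)
Lemma bin_expn_le p : 'C(n, p)%:R * n%:R^-1 ^+ p <= 1 :> R.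
Proof.
rewrite exprVn ler_pdivrMr ?exprn_gt0 ?ltr0n// mul1r -natrX ler_nat.
elim: p => [|p IH]; first by rewrite bin0.
rewrite expnS -(leq_pmul2l (ltn0Sn p)) mul_bin_left.
rewrite mulnA; apply: leq_mul => //.
by apply: leq_trans (leq_subr _ _) _; rewrite leq_pmull.
Qed.

Lemma chaos_sum :
  `|\int[mu]_x (TE x * F 1 (LE x)) - \sum_(1 <= p < k.+1) kappaE p * gE p| <=
  C * (1 + c1) * \int[mu]_x (TE x ^+ 2) + C * (k%:R * (2 * k%:R + c1)) * beta.
Proof.
have c10 : 0 <= c1 by rewrite /c1 !addr_ge0 ?m3_ge0.
have -> : \int[mu]_x (TE x * F 1 (LE x)) =
    \sum_(A : {set 'I_n} | (0 < #|A| <= k)%N) \int[mu]_x (tA A x * F 1 (LE x)).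
  under eq_Rintegral do rewrite TE_sum mulr_suml.
  rewrite Rint_sum// => A Ak; apply: intgM; first exact: tA_sq.
  exact: F1_sqint.
have -> : \sum_(1 <= p < k.+1) kappaE p * gE p =
    \sum_(A : {set 'I_n} | (0 < #|A| <= k)%N) \int[mu]_x (Lprod A x * tA A x) * gE #|A|.
  rewrite -sum_by_card; apply: eq_big_nat => p pk.
  rewrite kappaE_sum// mulr_suml; apply: eq_bigr => A /eqP ->; by [].
rewrite -sumrB; apply: (le_trans (ler_norm_sum _ _ _)).
apply: (le_trans (ler_sum _ chaos_term)).
(* Orthogonality reassembles the second moments of the components into that of [TE]. *)
rewrite big_split/= -mulr_sumr -(Rint_TE2 iid t_sym t_intg t_deg TE_sq) lerD2l.
rewrite -(sum_by_card (fun A => C * (2 * #|A|%:R + c1) * (beta * n%:R^-1 ^+ #|A|))).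
apply: (@le_trans _ _ (\sum_(1 <= p < k.+1) C * (2 * k%:R + c1) * beta)).
  rewrite big_nat [leRHS]big_nat; apply: ler_sum => p pk.
  rewrite (eq_bigr (fun=> C * (2 * p%:R + c1) * (beta * n%:R^-1 ^+ p))); last first.
    by move=> A /eqP ->.
  rewrite sumr_const (_ : #|_| = 'C(n, p)); last first.
    by rewrite -[in RHS](card_ord n) -card_draws cardsE.
  rewrite -[_ *+ 'C(n, p)]mulr_natl.
  have -> : 'C(n, p)%:R * (C * (2 * p%:R + c1) * (beta * n%:R^-1 ^+ p)) =
    C * (2 * p%:R + c1) * beta * ('C(n, p)%:R * n%:R^-1 ^+ p) by ring.
  rewrite -[leRHS]mulr1; apply: ler_pM.
  - apply: mulr_ge0; last exact: ltW.
    by apply: mulr_ge0; [exact: C0|rewrite addr_ge0// mulr_ge0].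
  - by rewrite mulr_ge0 ?exprn_ge0 ?invr_ge0.
  - rewrite ler_wpM2r ?(ltW beta0)// ler_wpM2l// lerD2r ler_pM2l// ler_nat.
    by case/andP: pk.
  - exact: bin_expn_le.
rewrite sumr_const_nat subn1 /= -[_ *+ k]mulr_natl.
by rewrite le_eqVlt; apply/orP; left; apply/eqP; ring.
Qed.

(** The constant generously dominates both the coefficient [2 + c1] of the second moment of [TE] and
    the coefficient [1 + m3 + k * (2 * k + c1)] of [beta]. *)
Lemma expansion :
  `|\int[mu]_x F 0 (LE x + TE x) - (gaussE (F 0) + \sum_(1 <= p < k.+1) kappaE p * gE p)| <=
  (3 + m3 + c1 + k%:R * (2 * k%:R + c1)) * C * (beta + \int[mu]_x (TE x ^+ 2)).
Proof.
have d0 : has_deriv (F 0) (F 1) by apply: F_deriv; rewrite addn4.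
have d2 : has_deriv (F 2) (F 3) by apply: F_deriv; rewrite addn4.
have b2 x : `|F 2 x| <= C by apply: F_bound; rewrite addn4.
have b3 x : `|F 3 x| <= C by apply: F_bound; rewrite addn4.
have S := smooth3_deriv d0 F1_deriv d2 b2 b3.
have IS : intg mu (fun x => F 0 (LE x + TE x)) := smooth3_intg S (sqintD LE_sq TE_sq).
have IL : intg mu (fun x => F 0 (LE x)) := smooth3_intg S LE_sq.
have IT : intg mu (fun x => TE x * F 1 (LE x)) := intgM TE_sq (F1_sqint LE_sq).
have h1 : `|\int[mu]_x F 0 (LE x + TE x) - \int[mu]_x F 0 (LE x) -
    \int[mu]_x (TE x * F 1 (LE x))| <= C * \int[mu]_x (TE x ^+ 2).
  rewrite -RintB// -RintB//; last exact: intgB.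
  rewrite -RintZ; last exact: TE_sq.2.
  apply: Rint_abs_le.
  - by apply: (intg_measurable (mu := mu)); apply: intgB => //; exact: intgB.
  - by apply: intgZ; exact: TE_sq.2.
  by move=> x; apply: taylor2 d0 F1_deriv _ => s _.
have h2 := lindeberg iid n_gt0 ml l_mean l_var l_intg3 l_third d0 F1_deriv d2 b2 b3.
have h3 := chaos_sum.
have c10 : 0 <= c1 by rewrite /c1 !addr_ge0 ?m3_ge0.
have g0 : 0 <= \int[mu]_x (TE x ^+ 2) by apply: Rintegral_ge0 => x _; exact: sqr_ge0.
move: h1 h2 h3 g0; set I0 := \int[mu]_x F 0 (LE x + TE x).
set I1 := \int[mu]_x F 0 (LE x); set I2 := \int[mu]_x (TE x * F 1 (LE x)).
set g := \int[mu]_x (TE x ^+ 2); set K := \sum_(1 <= p < k.+1) _; set G := gaussE _.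
move=> h1 h2 h3 g0.
have -> : I0 - (G + K) = (I0 - I1 - I2) + (I1 - G) + (I2 - K) by ring.
apply: (le_trans (ler_normD _ _)).
apply: (le_trans (lerD (ler_normD _ _) (lexx _))).
apply: (le_trans (lerD (lerD h1 h2) h3)).
have m0 : 0 <= m3 :> R := m3_ge0.
have Cg : 0 <= C * g by rewrite mulr_ge0.
have Cb : 0 <= C * beta by rewrite mulr_ge0// ltW.
have k0 : 0 <= k%:R * (2 * k%:R + c1) :> R by rewrite mulr_ge0 ?addr_ge0 ?mulr_ge0.
rewrite -subr_ge0.
have -> : (3 + m3 + c1 + k%:R * (2 * k%:R + c1)) * C * (beta + g) -
  (C * g + C * (1 + m3) * beta + (C * (1 + c1) * g + C * (k%:R * (2 * k%:R + c1)) * beta)) =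
  (1 + m3 + k%:R * (2 * k%:R + c1)) * (C * g) + (2 + c1) * (C * beta) by ring.
by rewrite addr_ge0// mulr_ge0// ?addr_ge0.
Qed.

End remainder.
End expansion.

(** * Transfer to an arbitrary probability space *)

Section transfer.
Context d (T : measurableType d) (R : realType) (P : probability T R) (n : nat).
Variable X : 'I_n -> {RV P >-> R}.

Definition Xvec (w : T) : space R n := fun i => X i w.

Lemma measurable_Xvec : measurable_fun [set: T] Xvec.
Proof. by apply: measurable_to_space => i; exact: measurable_funP. Qed.

Definition joint : {mfun T >-> space R n} :=
  MeasurableFun.Pack (MeasurableFun.Class
    (isMeasurableFun.Build _ _ _ _ _ measurable_Xvec)).

Lemma joint_iid (i0 : 'I_n) : mutually_independent P (fun i => X i : T -> R) ->
  identically_distributed P (fun i => X i : T -> R) ->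
  iid_law (distribution P joint) (distribution P (X i0)).
Proof.
move=> ind idd B mB; rewrite [LHS](ind B mB).
by apply: eq_bigr => i _; rewrite (idd i i0).
Qed.

(** This connects the two forms of degeneracy: sets of sample points insensitive to certain
    coordinates pull back to events generated by the other variables. Freezing the irrelevant
    coordinates at 0 leaves the event unchanged and reduces the claim to cylinders. *)
Lemma sigma_gen_preimage (J : set 'I_n) (J' : {set 'I_n}) (D : set (space R n)) :
  (forall j, j \in J' -> J j) -> measurable D -> depends_on J' D ->
  sigma_gen (fun i => X i : T -> R) J (Xvec @^-1` D).
Proof.
move=> JJ' mD dD.
pose r (w : T) : space R n := fun i => if i \in J' then X i w else 0.
have -> : Xvec @^-1` D = r @^-1` D.
  by apply/seteqP; split => w /=; rewrite (dD (r w) (Xvec w))// => j jJ; rewrite /r /Xvec jJ.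
pose H := [set B : set (space R n) | sigma_gen (fun i => X i : T -> R) J (r @^-1` B)].
have sg : sigma_algebra [set: T] (sigma_gen (fun i => X i : T -> R) J).
  exact: smallest_sigma_algebra.
apply: (mD H); split.
  have [s0 sC sU] := sg; split.
  - by rewrite /H /= preimage_set0.
  - by move=> B HB; rewrite /H /= setTD preimage_setC -setTD; exact: sC.
  - by move=> B HB; rewrite /H /= preimage_bigcup; exact: sU.
move=> _ [i [B [mB ->]]]; rewrite /H /= /r.
have [iJ|iJ] := boolP (i \in J').
  apply: sub_gen_smallest; exists i, B; split; first exact: JJ'.
  by split => //; apply/seteqP; split => w; rewrite /= iJ.
(* A cylinder over a frozen coordinate pulls back to everything or to nothing, according to whether
   [B] contains 0. *)
have [B0|B0] := pselect (B 0).
  rewrite (_ : _ @^-1` _ = setT).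
    have [s0 sC _] := sg; rewrite -(setD0 [set: T]); exact: sC.
  by apply/seteqP; split => w //= _; rewrite (negbTE iJ).
rewrite (_ : _ @^-1` _ = set0); first by have [] := sg.
by apply/seteqP; split => w //=; rewrite (negbTE iJ).
Qed.

End transfer.

(** * Moduli and suprema of complex-valued test functions *)

Section bounds.
Context {R : realType}.
Implicit Types a b : R.

Lemma cmod_ge0 a b : 0 <= cmod a b.
Proof. exact: sqrtr_ge0. Qed.

Lemma norm_le_cmodl a b : `|a| <= cmod a b.
Proof. by rewrite /cmod -sqrtr_sqr ler_wsqrtr// lerDl sqr_ge0. Qed.

Lemma norm_le_cmodr a b : `|b| <= cmod a b.
Proof. by rewrite /cmod -sqrtr_sqr ler_wsqrtr// lerDr sqr_ge0. Qed.

Lemma cmod_le_normD a b : cmod a b <= `|a| + `|b|.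
Proof.
rewrite /cmod -[leRHS]ger0_norm ?addr_ge0// -sqrtr_sqr ler_wsqrtr//.
rewrite -[a ^+ 2]real_normK ?num_real// -[b ^+ 2]real_normK ?num_real//.
by have := mulr_ge0 (normr_ge0 a) (normr_ge0 b); lra.
Qed.

Lemma cmod_le_csupnorm (fr fi : R -> R) (M : R) x :
  (forall y, cmod (fr y) (fi y) <= M) -> cmod (fr x) (fi x) <= csupnorm fr fi.
Proof.
move=> hM; apply: ub_le_sup; last by exists x.
by exists M => _ [y _ <-].
Qed.

Lemma derive1n_has_deriv (f : R -> R) j : (forall x, derivable (derive1n j f) x 1) ->
  has_deriv (derive1n j f) (derive1n j.+1 f).
Proof. by move=> df x; rewrite derive1nS derive1E; exact: derivableP. Qed.

End bounds.

Theorem theorem5 (R : realType) (k : nat) (hk : (0 < k)%N) :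
  exists c : R, 0 < c /\
  forall (d : measure_display) (T : measurableType d) (P : probability T R)
    (n : nat) (hn : (0 < n)%N) (X : 'I_n -> {RV P >-> R})
    (l : R -> R) (t : forall p : nat, ('I_p -> R) -> R)
    (fr fi : R -> R),
    (* X_1, ..., X_n i.i.d. *)
    mutually_independent P (fun i => X i : T -> R) ->
    identically_distributed P (fun i => X i : T -> R) ->
    (* l and t_p Borel, t_p symmetric *)
    measurable_fun [set: R] l ->
    (forall p, borel_fun_p (t p)) ->
    (forall p, symmetric_fun (t p)) ->
    (* E L_1 = 0, n E L_1^2 = 1 *)
    ('E_P[(fun w => l (X (Ordinal hn) w))%R] = 0)%E ->
    (n%:R%:E * 'E_P[(fun w => l (X (Ordinal hn) w) ^+ 2)%R] = 1)%E ->
    (* t_p(X_1,...,X_p) integrable and degenerate, 1 <= p <= k (and p <= n) *)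
    (forall p : nat, (1 <= p <= k)%N -> (p <= n)%N ->
       let A := [set i : 'I_n | (i < p)%N]%SET in
       P.-integrable [set: T] (fun w => (TA t (fun i => X i : T -> R) A w)%:E) /\
       (forall E, sigma_gen (fun i => X i : T -> R) [set j : 'I_n | (1 <= j < p)%N] E ->
          'E_P[(fun w => TA t (fun i => X i : T -> R) A w * \1_E w)%R] = 0)%E) ->
    (* beta < oo, gamma < oo *)
    ('E_P[(fun w => `|l (X (Ordinal hn) w)| ^+ 3)%R] < +oo)%E ->
    (variance P (TT k t (fun i => X i : T -> R)) < +oo)%E ->
    (* f = fr + i fi is k+4 times continuously differentiable *)
    (forall j x, (j < k + 4)%N -> derivable (derive1n (j) fr) x 1 /\ derivable (derive1n (j) fi) x 1) ->
    continuous (derive1n (k + 4) fr) -> continuous (derive1n (k + 4) fi) ->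
    (* f'', ..., f^(k+4) bounded *)
    (forall j, (2 <= j <= k + 4)%N ->
       exists M : R, forall x, cmod (derive1n j fr x) (derive1n j fi x) <= M) ->
    let S := SS k l t (fun i => X i : T -> R) in
    let kap := kappa P k l t (fun i => X i : T -> R) in
    let Cf := \sum_(2 <= j < k + 5) csupnorm (derive1n (j) fr) (derive1n (j) fi) in
    let beta := (n%:R%:E * 'E_P[(fun w => `|l (X (Ordinal hn) w)| ^+ 3)%R])%E in
    let gamma := variance P (TT k t (fun i => X i : T -> R)) in
    ((cmod (fine 'E_P[(fun w => fr (S w))%R] - int_dNk kap k fr)
           (fine 'E_P[(fun w => fi (S w))%R] - int_dNk kap k fi))%:E
       <= (c * Cf)%:E * (beta + gamma))%E.
Proof.
pose c0 : R := 3 + m3 + (k%:R + 2 + m3) + k%:R * (2 * k%:R + (k%:R + 2 + m3)).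
have c00 : 0 < c0.
  by rewrite /c0 !ltr_wpDr ?addr_ge0 ?mulr_ge0 ?addr_ge0 ?m3_ge0 ?mulr_ge0.
(* [c0] is the constant of [expansion]; the factor 2 pays for treating real and imaginary parts
   separately and adding their absolute values. *)
exists (2 * c0); split; first by rewrite mulr_gt0.
move=> d T P n hn X l t fr fi ind idd ml tb ts El El2 ht hbeta hgamma df.
move=> _ _ bf.
cbv zeta.
pose St := SS k l t (fun i => X i : T -> R); pose kap := kappa P k l t (fun i => X i : T -> R).
pose Cf := \sum_(2 <= j < k + 5) csupnorm (derive1n j fr) (derive1n j fi).
pose beta := (n%:R%:E * 'E_P[(fun w => `|l (X (Ordinal hn) w)| ^+ 3)%R])%E.
pose gamma := variance P (TT k t (fun i => X i : T -> R)).
rewrite -/St -/kap -/Cf -/beta -/gamma.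
pose i0 := Ordinal hn; pose mu := distribution P (joint X); pose nu := distribution P (X i0).
have iid : iid_law mu nu := joint_iid i0 ind idd.
have mX := measurable_Xvec X.
have mX0 : measurable_fun [set: T] (X i0) by exact: measurable_funP.
have lawX B : measurable B -> P (Xvec X @^-1` B) = mu B by [].
have lawX0 B : measurable B -> P (X i0 @^-1` B) = nu B by [].
have ml3 : measurable_fun [set: R] (fun y => `|l y| ^+ 3).
  by apply: measurable_funX; exact: measurableT_comp.
have PI3 : intg P (fun w => `|l (X i0 w)| ^+ 3).
  apply/integrableP; split; first by apply/measurable_EFinP; exact: (measurableT_comp ml3).
  move: hbeta; rewrite unlock => h; rewrite (le_lt_trans _ h)//.
  by under eq_integral do rewrite /= ger0_norm ?exprn_ge0//.
have I3 : intg nu (fun y => `|l y| ^+ 3) by apply/(intg_transport mX0 lawX0 ml3).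
have I2 := l_intg2 ml I3; have I1 := l_intg ml I3.
have hmean : \int[nu]_y l y = 0.
  by rewrite -(Rint_transport mX0 lawX0 I1) /Rintegral -[RHS](congr1 fine El) unlock.
have hvar : \int[nu]_y (l y ^+ 2) = n%:R^-1.
  move: El2; rewrite unlock -(EFin_Rint (mu := P)); last first.
    by apply/(intg_transport mX0 lawX0 (intg_measurable I2)).
  rewrite (Rint_transport mX0 lawX0 I2) -EFinM => -[] h.
  apply: (mulfI (_ : n%:R != 0 :> R)); first by rewrite pnatr_eq0 -lt0n.
  by rewrite h mulfV// pnatr_eq0 -lt0n.
pose br := n%:R * \int[nu]_y (`|l y| ^+ 3).
have betaE : beta = br%:E.
  rewrite /beta /br unlock EFinM -(Rint_transport mX0 lawX0 I3) EFin_Rint//.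
have mtA A : measurable_fun [set: space R n] (tA t A) := measurable_tA tb A.
have tI p : (1 <= p <= k)%N -> (p <= n)%N -> intg mu (tA t (initial_set n p)).
  move=> pk pn; apply/(intg_transport mX lawX (mtA _)).
  exact: (ht p pk pn).1.
have tD p : (1 <= p <= k)%N -> (p <= n)%N -> forall D : set (space R n), measurable D ->
    depends_on [set j : 'I_n | (1 <= j < p)%N]%SET D ->
    \int[mu]_x (tA t (initial_set n p) x * \1_D x) = 0.
  move=> pk pn D mD dD.
  have ID : intg mu (fun x => tA t (initial_set n p) x * \1_D x).
    apply: (intgMb (M := 1) (tI p pk pn)); first exact: measurable_indic.
    by move=> x; rewrite indicE; case: (_ \in _); rewrite ?normr1 ?normr0.
  rewrite -(Rint_transport mX lawX ID).
  have JJ (j : 'I_n) : j \in [set j : 'I_n | (1 <= j < p)%N]%SET ->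
      [set j : 'I_n | (1 <= j < p)%N] j by rewrite inE.
  have sD := sigma_gen_preimage (X := X) JJ mD dD.
  have := (ht p pk pn).2 _ sD.
  by rewrite unlock => /(congr1 fine).
have IT : intg mu (@TE R n k t) := TE_intg iid ts tI.
have mT := intg_measurable IT.
have PT : intg P (TT k t (fun i => X i : T -> R)) by apply/(intg_transport mX lawX mT).
have ET0 : fine 'E_P[TT k t (fun i => X i : T -> R)] = 0.
  rewrite unlock -[RHS](Rint_TE0 iid ts tI tD).
  exact: (Rint_transport mX lawX IT).
(* The mean being zero, the variance is the plain second moment; its finiteness is what makes [TE]
   square integrable. *)
have gammaE : gamma = (\int[P]_w ((TT k t (fun i => X i : T -> R) w) ^+ 2)%:E)%E.
  rewrite /gamma /variance covariance.unlock ET0 expectation.unlock.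
  apply: eq_integral => w _; set U := TT k t _.
  transitivity ((U w - 0) * (U w - 0))%:E => //.
  by rewrite subr0 -expr2.
have PT2 : intg P (fun w => TT k t (fun i => X i : T -> R) w ^+ 2).
  apply/integrableP; split.
    by apply/measurable_EFinP; apply: measurable_funX; exact: intg_measurable PT.
  move: hgamma; rewrite -/gamma gammaE => h; rewrite (le_lt_trans _ h)//.
  by under eq_integral do rewrite /= ger0_norm ?sqr_ge0//.
have sT : sqint mu (@TE R n k t).
  split; first exact: mT.
  by apply/(intg_transport mX lawX) => //; exact: measurable_funX.
have gE : gamma = (\int[mu]_x (@TE R n k t x ^+ 2))%:E.
  by rewrite gammaE -(Rint_transport mX lawX sT.2) EFin_Rint.
have Lsq A := Lprod_sqint iid ml hvar I3 A.
have kapE p : kap p = @kappaE R n k mu t l p.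
  rewrite /kap /kappa /kappaE; congr (_ * _).
  rewrite -(Rint_transport mX lawX (intgM (Lsq (initial_set n p)) sT)) unlock /Rintegral; congr fine.
  apply: eq_integral => w _; congr ((_ * _)%:E).
  by apply: eq_bigl => i; rewrite inE.
have cs0 j : (2 <= j <= k + 4)%N -> 0 <= csupnorm (derive1n j fr) (derive1n j fi).
  move=> jk; have [M hM] := bf j jk.
  exact: le_trans (cmod_ge0 _ _) (cmod_le_csupnorm 0 hM).
have csC j x : (2 <= j <= k + 4)%N -> cmod (derive1n j fr x) (derive1n j fi x) <= Cf.
  move=> jk; have [M hM] := bf j jk.
  apply: (le_trans (cmod_le_csupnorm x hM)).
  have jr : j \in index_iota 2 (k + 5) by rewrite mem_index_iota; lia.
  rewrite /Cf (bigD1_seq j jr (iota_uniq _ _))/=.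
  rewrite lerDl big_seq_cond; apply: sumr_ge0 => i /andP[].
  by rewrite mem_index_iota => ik _; apply: cs0; lia.
have main (f : R -> R) :
    (forall j, (j < k + 4)%N -> has_deriv (derive1n j f) (derive1n j.+1 f)) ->
    (forall j, (2 <= j <= k + 4)%N -> forall x, `|derive1n j f x| <= Cf) ->
    `|fine 'E_P[(fun w => f (St w))%R] - int_dNk kap k f| <=
      c0 * Cf * (br + \int[mu]_x (@TE R n k t x ^+ 2)).
  move=> dfj bfj.
  have := @expansion R n k mu nu iid t ts tI tD l br hn ml hmean hvar I3 erefl sT
    (fun j => derive1n j f) Cf dfj bfj.
  rewrite /c0; congr (`|_ - _| <= _).
    have Sm : smooth3 Cf Cf f (derive1n 1 f) (derive1n 2 f).
      apply: (@smooth3_deriv _ f _ _ (derive1n 3 f)).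
      - by apply: (dfj 0%N); lia.
      - by apply: (dfj 1%N); lia.
      - by apply: (dfj 2%N); lia.
      - by apply: bfj; lia.
      - by apply: bfj; lia.
    have If : intg mu (fun x => f (LE l x + @TE R n k t x)).
      apply: smooth3_intg Sm _; apply: sqintD => //; exact: (LE_sqint iid ml I3).
    by rewrite unlock /= -(Rint_transport mX lawX If).
  rewrite /int_dNk; congr (_ + _).
  by apply: eq_bigr => p _; rewrite kapE.
have hr := main fr _ _; have hi := main fi _ _.
rewrite betaE gE -EFinD -EFinM lee_fin.
apply: (le_trans (cmod_le_normD _ _)).
apply: le_trans (lerD (hr _ _) (hi _ _)) _.
- by move=> j jk; apply: derive1n_has_deriv => x; exact: (df j x jk).1.
- by move=> j jk x; apply: le_trans (norm_le_cmodl _ _) (csC j x jk).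
- by move=> j jk; apply: derive1n_has_deriv => x; exact: (df j x jk).2.
- by move=> j jk x; apply: le_trans (norm_le_cmodr _ _) (csC j x jk).
by rewrite le_eqVlt; apply/orP; left; apply/eqP; ring.
Qed.
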